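(* Fix $\mathrm{acv}_0>0$, $\mathrm{arb}_0\in(0,1)$ and $b\ge0$. For $\zeta\in(0,1)$ let $\nu^\dagger=\log_\zeta\mathrm{arb}_0+b$, and let $(n_1^{\mathrm{opt}},n_2^{\mathrm{opt}})$ denote the optimal sample sizes for $\mathscr T_{\nu^\dagger}$ (see context) that also satisfy $\operatorname{ACV}\mathscr T_{\nu^\dagger}(n_1^{\mathrm{opt}},n_2^{\mathrm{opt}}\mid\zeta,\nu^\dagger)=\mathrm{acv}_0$ (and $\operatorname{ARB}\mathscr T_{\nu^\dagger}=\mathrm{arb}_0\zeta^b$, which holds by the choice of $\nu^\dagger$). Then as $\zeta\to1^-$, $n_2^{\mathrm{opt}}/n_1^{\mathrm{opt}}\to1$ and $$n_i^{\mathrm{opt}}\sim C\,(1-\zeta)^{-2},\qquad i=1,2,$$ where $C=C_{\mathscr T_{\nu^\dagger}}$ is the solution of $A(C,\mathrm{arb}_0)-\mathrm{acv}_0^2=0$ with $$A(C,\mathrm{arb}_0)=\frac{(C/4)e^{-C/4}}{(1-\mathrm{arb}_0)^2}\left(\operatorname{Ei}\!\left(\tfrac C4\right)-2\operatorname{Ei}\!\left(\log\mathrm{arb}_0+\tfrac C4\right)+\operatorname{Ei}\!\left(\tfrac{(C/4+\log\mathrm{arb}_0)^2}{C/4}\right)\right)-1 .$$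
   Context: $\operatorname{Ei}$ is the exponential integral; for real $z\neq0$, $\operatorname{Ei}(z)=\int_0^z\frac{e^t-1}{t}dt+\log|z|+\gamma$ with $\gamma$ Euler's constant (the removable singularity of the bracket at $C/4=-\log\mathrm{arb}_0$ is filled by continuity). $\mathscr T_\nu$ is an estimator of $(\kappa_1-\kappa_2)^{-1}$ based on two independent gamma variables $Y_i$ (sample variances of normal samples of sizes $n_i$) with shape $\alpha_i=(n_i-1)/2$ and rate $\alpha_i/\kappa_i$, $\zeta=\kappa_2/\kappa_1$: $$\mathscr T_\nu=\frac{\alpha_1-1}{\alpha_1Y_1}\Bigl({}_2F_1(1,2-\alpha_1;\alpha_2;-Z)-\frac{Z^\nu}{(\alpha_1-1)_{-\nu}(\alpha_2)_\nu}{}_2F_1(1,2-\alpha_1+\nu;\alpha_2+\nu;-Z)\Bigr),\quad Z=\frac{\alpha_2Y_2}{\alpha_1Y_1},\quad (s)_w=\frac{\Gamma(s+w)}{\Gamma(s)} .$$ It has absolute relative bias $\operatorname{ARB}\mathscr T_\nu=\zeta^\nu$ and its absolute coefficient of variation $\operatorname{ACV}=\sqrt{\operatorname{Var}}/|\mathsf E|$ is given by $$\operatorname{ACV}^2\mathscr T_\nu(n_1,n_2\mid\zeta,\nu)=\sum_{k=1}^\infty\sum_{\ell=0}^k\frac{\tilde g_{k,\ell}^2(\zeta,\nu)}{(\alpha_1)_\ell(\alpha_2)_{k-\ell}\,\ell!\,(k-\ell)!},\quad \tilde g_{n,\omega}(z,\nu)=n!\,\frac{(\omega+\nu)^{(n+1)}}{\nu}\,\frac{\mathbf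 F(1,\omega+\nu+1;n+2;1-z)}{\mathbf F(1,\nu+1;2;1-z)},$$ where $(s)^{(n)}=\prod_{k=0}^{n-1}(s-k)$, $\mathbf F(a,b;c;x)={}_2F_1(a,b;c;x)/\Gamma(c)$. The sample sizes are treated as real numbers, and the series takes values in $[0,\infty]$. Optimal sample sizes (for an estimator $T$ whose ACV depends on $(n_1,n_2)$): for a given total $\mathrm N>0$, the pair $(n_1,n_2)$ minimizing $\operatorname{ACV}T(n_1,n_2)$ subject to $n_1+n_2=\mathrm N$. Requiring additionally $\operatorname{ACV}T(n_1^{\mathrm{opt}},n_2^{\mathrm{opt}})=\mathrm{acv}_0$ determines $\mathrm N$, so the pair becomes a function of $\mathrm{acv}_0$ and the remaining parameters. *)

(* Defs.v *)
From HB Require Import structures.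
From mathcomp Require Import all_boot all_order all_algebra.
From mathcomp Require Import all_classical all_reals all_analysis.
Import Order.TTheory GRing.Theory Num.Theory.
Import numFieldNormedType.Exports.
Set Implicit Arguments.
Unset Strict Implicit.
Unset Printing Implicit Defensive.
Local Open Scope classical_set_scope.
Local Open Scope ring_scope.

Section Definitions.
Context {R : realType}.
Implicit Types (a b c x z s nu zeta : R) (n k l : nat).

(* [poch s n] is Gamma(s + n) / Gamma(s), usually written (s)_n. *)
Definition poch s n : R := \prod_(k < n) (s + k%:R).

(* Falling factorial, usually written (s)^{(n)}. *)
Definition ffactr s n : R := \prod_(k < n) (s - k%:R).

(* Only used with `|x| < 1, where the Gauss series converges. *)
Definition hyp2F1 a b c x : R :=
  limn (series (fun k => poch a k * poch b k / poch c k * x ^+ k / k`!%:R)).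

(* Regularized 2F1(a, b; c; x) / Gamma(c) at a positive integer c, for which
   Gamma(c) = (c - 1)!. *)
Definition reg2F1 a b (c : nat) x : R := hyp2F1 a b c%:R x / (c.-1)`!%:R.

Definition gtilde n (omega : nat) z nu : R :=
  n`!%:R * (ffactr (omega%:R + nu) n.+1 / nu)
  * (reg2F1 1 (omega%:R + nu + 1) n.+2 (1 - z) / reg2F1 1 (nu + 1) 2 (1 - z)).

(* Gamma shape parameter of the sample variance of a normal sample. *)
Definition shape (ss : R) : R := (ss - 1) / 2.

(* Squared absolute coefficient of variation of the estimator T_nu of
   1 / (kappa_1 - kappa_2), with zeta = kappa_2 / kappa_1 and real sample
   sizes n1, n2; the value +oo is possible. *)
Definition ACV2 (n1 n2 zeta nu : R) : \bar R :=
  (\sum_(1 <= k <oo) (\sum_(l < k.+1)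
     gtilde k l zeta nu ^+ 2 /
     (poch (shape n1) l * poch (shape n2) (k - l) * l`!%:R * (k - l)`!%:R))%:E)%E.

Definition ACV (n1 n2 zeta nu : R) : \bar R := sqrte (ACV2 n1 n2 zeta nu).

(* Absolute relative bias of T_nu. *)
Definition ARB zeta nu : R := zeta `^ nu.

(* A sample size must exceed 1 for its gamma shape to be positive. *)
Definition optimal_sizes (acv : R -> R -> \bar R) (N n1 n2 : R) : Prop :=
  [/\ 1 < n1, 1 < n2, n1 + n2 = N &
      forall m1 m2 : R, 1 < m1 -> 1 < m2 -> m1 + m2 = N ->
        (acv n1 n2 <= acv m1 m2)%E].

(* The total N is not prescribed but determined by the attained value acv0. *)
Definition optimal_sizes_at (acv : R -> R -> \bar R) (acv0 n1 n2 : R) : Prop :=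
  exists N : R,
    [/\ 0 < N, optimal_sizes acv N n1 n2 & acv n1 n2 = acv0%:E].

Definition nu_dagger (arb0 b zeta : R) : R := ln arb0 / ln zeta + b.

Definition euler_gamma : R :=
  limn (fun n => \sum_(1 <= k < n.+1) k%:R^-1 - ln n%:R : R).

(* Oriented integral of (e^t - 1) / t from 0 to z. *)
Definition Ein_int z : R :=
  let f t := (expR t - 1) / t in
  if 0 <= z then \int[lebesgue_measure]_(t in `[0, z]) f t
  else - \int[lebesgue_measure]_(t in `[z, 0]) f t.

(* Exponential integral at real z != 0. *)
Definition Ei z : R := Ein_int z + ln `|z| + euler_gamma.

Definition bracket (arb0 c : R) : R :=
  Ei c - 2 * Ei (ln arb0 + c) + Ei ((c + ln arb0) ^+ 2 / c).

(* [bracket] with its removable singularity at c = - ln arb0 filled by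
   continuity. *)
Definition bracket_ext (arb0 c : R) : R :=
  if c != - ln arb0 then bracket arb0 c
  else lim (bracket arb0 x @[x --> (- ln arb0)^']).

Definition A (C arb0 : R) : R :=
  (C / 4) * expR (- (C / 4)) / (1 - arb0) ^+ 2 * bracket_ext arb0 (C / 4) - 1.

End Definitions.

(* Main.v *)
Require Import Defs.
From mathcomp Require Import all_boot all_order all_algebra.
From mathcomp Require Import all_classical all_reals all_analysis.
From mathcomp Require Import ring lra.
Import Order.TTheory GRing.Theory Num.Theory.
Import numFieldNormedType.Exports.
Set Implicit Arguments.
Unset Strict Implicit.
Unset Printing Implicit Defensive.
Local Open Scope classical_set_scope.
Local Open Scope ring_scope.

(* Put x = 1 - zeta and L = - ln arb0, so that nu x -> L as zeta -> 1.  For fixed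
   k and l, x ^ k times the coefficient g_{k,l} tends to a limit G_k that does not
   depend on l.  When the sizes are of order x ^ -2, the k-th term of ACV^2 is
   therefore close to G_k ^ 2 s ^ k / k!, where s = (2 / n1 + 2 / n2) / x ^ 2.
   Dominated convergence is licensed by the bound g_{k,l} = O((nu + 1)_l
   (nu + 1)_{k-l} / (k + 1)), which makes the k-th term O(k ^ -2) uniformly, and
   for the matching lower bound finitely many terms suffice.  Hence, to leading
   order, ACV^2 is an increasing function of s alone.  At a given total size s is
   smallest when n1 = n2, which gives both the ratio 1 and the value of C.
   The limit sum is identified with A by differentiating in L: for
   h_k(t) = P(Poisson(t) > k), both sum_k k! h_k(t) ^ 2 c ^ -k and the combination
   of exponential integrals have derivative 2 e^-t sum_k h_k(t) (t / c) ^ k. *)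

(** * Dominated convergence for series *)

(** The two directions are asymmetric. The lower bound on ACV^2 must hold for all pairs of sizes at
    once, including very unbalanced ones and those where the series is infinite. No common majorant
    exists there, whereas a finite partial sum can still be estimated uniformly. The limit of the
    full series is computed only on the diagonal, because an optimal pair is compared with the
    balanced pair of the same total. The attained value then bounds 1/n1 + 1/n2 from above, and
    optimality bounds n1 + n2 from above. These two bounds alone pin both sizes, so no convergence
    of the sizes has to be known beforehand.

    The scale x^-2 is a balance: g^2 grows like x^(-2k), and the product of the two Pochhammer
    symbols like the k-th power of the shapes. Poisson tails appear because 2F1(1, l + nu + 1; k +
    2; x) degenerates, when x nu -> L, to 1F1(1; k + 2; L), which is, up to a factor, the
    exponential series without its first k + 1 terms. *)

Section limits.
Context {R : realType}.

Lemma cvg_prodn (T : Type) (F : set_system T) (FF : Filter F) (n : nat)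
    (f : nat -> T -> R) (a : nat -> R) :
  (forall k, f k t @[t --> F] --> a k) ->
  (\prod_(k < n) f k t) @[t --> F] --> \prod_(k < n) a k.
Proof.
move=> fa; elim: n => [|n ih].
  rewrite big_ord0; under eq_fun do rewrite big_ord0; exact: cvg_cst.
rewrite big_ord_recr; under eq_fun do rewrite big_ord_recr /=.
exact: cvgM.
Qed.

Lemma cvg_sumn (T : Type) (F : set_system T) (FF : Filter F) (n : nat)
    (f : nat -> T -> R) (a : nat -> R) :
  (forall k, (k < n)%N -> f k t @[t --> F] --> a k) ->
  (\sum_(k < n) f k t) @[t --> F] --> \sum_(k < n) a k.
Proof.
elim: n => [|n ih] fa.
  rewrite big_ord0; under eq_fun do rewrite big_ord0; exact: cvg_cst.
rewrite big_ord_recr; under eq_fun do rewrite big_ord_recr /=.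
by apply: cvgD; [apply: ih => k kn; apply: fa; exact: ltnW|exact: fa].
Qed.

Lemma cvg_exprn (T : Type) (F : set_system T) (FF : Filter F) (n : nat)
    (f : T -> R) (a : R) :
  f t @[t --> F] --> a -> f t ^+ n @[t --> F] --> a ^+ n.
Proof.
move=> fa; elim: n => [|n ih].
  rewrite expr0; under eq_fun do rewrite expr0; exact: cvg_cst.
rewrite exprS; under eq_fun do rewrite exprS /=.
exact: cvgM.
Qed.

Lemma is_cvg_series_dominated (u M : R ^nat) :
  cvgn (series M) -> (forall k, `|u k| <= M k) -> cvgn (series u).
Proof.
move=> cM uM; apply: normed_cvg; apply: series_le_cvg cM => //= k.
exact: le_trans (uM k).
Qed.

Lemma series_tail_dominated (u M : R ^nat) n :
  cvgn (series M) -> (forall k, `|u k| <= M k) ->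
  `|limn (series u) - series u n| <= limn (series M) - series M n.
Proof.
move=> cM uM; have cu := is_cvg_series_dominated cM uM.
have -> : limn (series u) - series u n = lim ((series u m - series u n) @[m --> \oo]).
  by apply/esym/cvg_lim => //; apply: cvgB => //; exact: cvg_cst.
have -> : limn (series M) - series M n = lim ((series M m - series M n) @[m --> \oo]).
  by apply/esym/cvg_lim => //; apply: cvgB => //; exact: cvg_cst.
have cB (v : R ^nat) : cvgn (series v) -> cvg ((series v m - series v n) @[m --> \oo]).
  by move=> cv; apply: cvgP (cvgB cv (cvg_cst _)).
rewrite -lim_norm; last exact: cB.
apply: ler_lim.
- exact: is_cvg_norm (cB _ cu).
- exact: cB.
- near=> m.
  rewrite !sub_series_geq; [|by near: m; exact: nbhs_infty_ge..].
  by apply: le_trans (ler_norm_sum _ _ _) _; apply: ler_sum.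
Unshelve. all: by end_near. Qed.

(** The three-epsilon argument: beyond a fixed index both tails are controlled by the tail of [M],
    and the head is a finite sum. The filter is arbitrary because the lemma serves for zeta -> 1,
    for continuity in one and in two variables, and for difference quotients. *)
Lemma tannery (T : Type) (F : set_system T) (FF : ProperFilter F)
    (f : nat -> T -> R) (a M : R ^nat) :
  cvgn (series M) -> (forall k, f k t @[t --> F] --> a k) ->
  (\forall t \near F, forall k, `|f k t| <= M k) ->
  limn (series (f ^~ t)) @[t --> F] --> limn (series a).
Proof.
move=> cM fa fM.
have aM k : `|a k| <= M k.
  have /cvg_lim <- // := @cvg_norm _ _ _ _ FF _ _ (fa k).
  apply: limr_le; first exact: is_cvg_norm (cvgP _ (fa k)).
  by apply: filterS fM.
apply/cvgrPdist_lt => e e0.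
have e3 : 0 < e / 3 by rewrite divr_gt0.
have /cvgrPdist_lt/(_ _ e3)[n _ /(_ n (leqnn n))/= Mn] := cM.
have fan : series (f ^~ t) n @[t --> F] --> series a n.
  rewrite seriesEord; under eq_fun do rewrite seriesEord.
  by apply: cvg_sumn => k _; exact: fa.
have /cvgrPdist_lt/(_ _ e3) fane := fan.
near=> t.
have tail1 := series_tail_dominated n cM aM.
have tail2 : `|limn (series (f ^~ t)) - series (f ^~ t) n|
   <= limn (series M) - series M n.
  by apply: series_tail_dominated => //; near: t.
have mid : `|series a n - series (f ^~ t) n| < e / 3 by near: t.
have := ler_norm (limn (series M) - series M n).
set A := limn (series a) in tail1 *; set B := limn (series (f ^~ t)) in tail2 *.
have -> : A - B = (A - series a n) + (series a n - series (f ^~ t) n)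
   - (B - series (f ^~ t) n) by ring.
move=> ?; apply: le_lt_trans (ler_normB _ _) _.
have := ler_normD (A - series a n) (series a n - series (f ^~ t) n).
lra.
Unshelve. all: by end_near. Qed.

(** From index [J] on, each factor is at most w_(k+1) / w_k and the product telescopes; each earlier
    factor costs at most one extra [B]. The weight is geometric for [hyp_majorant], and 1 / (k + 1)
    for the Raabe-type bound. *)
Lemma ratio_bound (r w : R ^nat) (B : R) (J : nat) :
  1 <= B -> (forall k, 0 <= r k) -> (forall k, 0 < w k) ->
  (forall k, (k < J)%N -> r k * w k <= B * w k.+1) ->
  (forall k, (J <= k)%N -> r k * w k <= w k.+1) ->
  forall n, \prod_(k < n) r k <= B ^+ J * (w n / w 0%N).
Proof.
move=> B1 r0 w0 rJ rK n.
have B0 : 0 <= B by rewrite (le_trans _ B1).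
suff : (\prod_(k < n) r k) * w 0%N <= B ^+ minn n J * w n.
  rewrite mulrA ler_pdivlMr // => /le_trans; apply.
  by rewrite ler_wpM2r ?(ltW (w0 _))// ler_weXn2l// geq_minr.
elim: n => [|n ih]; first by rewrite big_ord0 min0n expr0.
rewrite big_ord_recr /= mulrAC.
apply: (@le_trans _ _ (B ^+ minn n J * w n * r n)); first by rewrite ler_wpM2r.
rewrite -mulrA [w n * _]mulrC.
have [nJ|Jn] := ltnP n J.
  have -> : minn n.+1 J = n.+1 by apply/minn_idPl.
  rewrite exprSr -mulrA.
  by rewrite ler_wpM2l ?exprn_ge0//; exact: rJ.
have -> : minn n.+1 J = J by apply/minn_idPr/leqW.
by rewrite ler_wpM2l ?exprn_ge0//; exact: rK.
Qed.

Lemma is_derive_continuous (f : R -> R) (x df : R) :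
  is_derive x (1 : R) f df -> {for x, continuous f}.
Proof. by move=> [/derivable1_diffP/differentiable_continuous]. Qed.

Lemma mean_value_le (f df : R -> R) (M b y z : R) :
  (forall u, is_derive u (1 : R) f (df u)) -> (forall u, `|u| < b -> `|df u| <= M) ->
  `|y| < b -> `|z| < b -> `|f y - f z| <= M * `|y - z|.
Proof.
move=> fdf dfM.
wlog yz : y z / z <= y.
  move=> H yb zb; case: (leP z y) => [zy|/ltW yz]; first exact: H.
  by rewrite distrC [`|y - z|]distrC; exact: H.
move=> yb zb.
have [|c cyz ->] := MVT_segment yz (fun x _ => fdf x).
  by apply/continuous_subspaceT => u; exact: is_derive_continuous.
rewrite normrM ler_wpM2r// dfM//.
move: cyz; rewrite in_itv /= => /andP[zc cy].
by move: yb zb; rewrite !ltr_norml => /andP[? ?] /andP[? ?]; apply/andP; split; lra.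
Qed.

(** By the mean value inequality [M] dominates the difference quotients as well as the derivatives,
    so Tannery applies along the punctured neighbourhood of 0. The normalisation at 0 turns the same
    inequality into convergence of the series itself. *)
Lemma is_derive_series (f df : nat -> R -> R) (M : R ^nat) (b x : R) :
  `|x| < b -> cvgn (series M) ->
  (forall k y, is_derive y (1 : R) (f k) (df k y)) ->
  (forall k y, `|y| < b -> `|df k y| <= M k) ->
  (forall k, f k 0 = 0) ->
  is_derive x (1 : R) (fun y => limn (series (f ^~ y))) (limn (series (df ^~ x))).
Proof.
move=> xb cM fdf dfM f0.
have incr k y z : `|y| < b -> `|z| < b -> `|f k y - f k z| <= M k * `|y - z|.
  by move=> yb zb; apply: (mean_value_le _ _ yb zb) => // u; exact: dfM.
have b0 : 0 < b by rewrite (le_lt_trans _ xb).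
have cf y : `|y| < b -> cvgn (series (f ^~ y)).
  move=> yb; have cMb : cvgn (series (b *: M)) by exact: is_cvg_seriesZ.
  apply: is_cvg_series_dominated cMb _ => k.
  have := incr k y 0 yb; rewrite normr0 f0 !subr0 => /(_ b0) /le_trans; apply.
  rewrite mulrC ler_wpM2r// ?(ltW yb)//.
  by apply: le_trans (dfM k 0 _); rewrite ?normr0.
have lim : h^-1 *: (limn (series (f ^~ (h + x))) - limn (series (f ^~ x))) @[h --> 0^'] -->
    limn (series (df ^~ x)).
  have bx : 0 < b - `|x| by rewrite subr_gt0.
  have xb' : \forall h \near 0^', `|h + x| < b.
    near=> h; have : `|h| < b - `|x| by near: h; exact: dnbhs0_lt.
    by have := ler_normD h x; lra.
  have H1 k : h^-1 * (f k (h + x) - f k x) @[h --> 0^'] --> df k x.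
    have [/cvg_ex[l dl] el] := fdf k x.
    have : (fun h : R => h^-1 *: ((f k \o shift x) (h *: 1) - f k x)) h @[h --> 0^'] --> df k x.
      by rewrite -el /derive; apply: cvgP dl.
    by under eq_fun do rewrite /= [_%:A]mulr1.
  have H2 : \forall h \near 0^', forall k, `|h^-1 * (f k (h + x) - f k x)| <= M k.
    near=> h => k.
    have hb : `|h + x| < b by near: h.
    have h0 : h != 0 by near: h; exact: nbhs_dnbhs_neq.
    rewrite normrM normrV ?unitfE// ler_pdivrMl ?normr_gt0// mulrC.
    by have := incr k _ _ hb xb; rewrite addrK.
  apply: cvg_trans (@tannery R 0^' _ _ _ _ cM H1 H2).
  apply: near_eq_cvg; near=> h.
  have hb : `|h + x| < b by near: h.
  have ch := cf _ hb; have cx := cf _ xb.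
  rewrite /= -lim_seriesB// -lim_seriesZ//; exact: is_cvg_seriesB.
apply: DeriveDef.
  apply/cvg_ex; exists (limn (series (df ^~ x))).
  by under eq_fun do rewrite /= [_%:A]mulr1.
rewrite /derive; under eq_fun do rewrite /= [_%:A]mulr1.
exact/cvg_lim.
Unshelve. all: by end_near. Qed.

End limits.

(** * Hypergeometric terms *)

Section pochhammer.
Context {R : realType}.
Implicit Types (s nu x L M q alpha : R) (k l n j : nat).

Lemma pochS s n : poch s n.+1 = poch s n * (s + n%:R).
Proof. by rewrite /poch big_ord_recr. Qed.

Lemma poch_gt0 s n : 0 < s -> 0 < poch s n.
Proof. by move=> s0; apply: prodr_gt0 => i _; rewrite ltr_wpDr. Qed.

Lemma poch1n n : poch 1 n = n`!%:R :> R.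
Proof.
elim: n => [|n ih]; first by rewrite /poch big_ord0.
by rewrite pochS ih factS natrM mulrC -natr1 addrC.
Qed.

Lemma ffactrD s m n : ffactr s (m + n) = ffactr s m * ffactr (s - m%:R) n.
Proof.
rewrite /ffactr big_split_ord /=; congr (_ * _); apply: eq_bigr => i _.
by rewrite natrD; ring.
Qed.

Lemma ffactr_poch nu l : ffactr (l%:R + nu) l.+1 = nu * poch (nu + 1) l.
Proof.
elim: l => [|l ih]; first by rewrite /ffactr /poch big_ord_recr !big_ord0 /=; ring.
have := ffactrD (l.+1%:R + nu) 1 l.+1; rewrite add1n => ->.
have -> : l.+1%:R + nu - 1%:R = l%:R + nu by rewrite -natr1; ring.
by rewrite ih pochS /ffactr big_ord_recr big_ord0 /= -natr1; ring.
Qed.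

(** The factors run downwards from nu + l. Those above nu form a rising product, those below nu a
    falling one, and the factor nu itself cancels the division by nu in [gtilde]. *)
Lemma ffactr_split nu k l : (l <= k)%N ->
  ffactr (l%:R + nu) k.+1 = nu * (poch (nu + 1) l * ffactr (nu - 1) (k - l)).
Proof.
move=> lk; rewrite -{1}(subnKC lk) -addSn ffactrD ffactr_poch mulrA.
by congr (_ * ffactr _ _); rewrite -natr1; ring.
Qed.

Lemma ffactr_norm_le nu n : 0 <= nu -> `|ffactr (nu - 1) n| <= poch (nu + 1) n.
Proof.
move=> nu0; rewrite /ffactr normr_prod; apply: ler_prod => i _.
rewrite normr_ge0 /= ler_norml; have := ler0n R i.
by move=> ?; apply/andP; split; lra.
Qed.

Lemma expr_prod_ord x n : x ^+ n = \prod_(i < n) x.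
Proof. by rewrite big_const_ord iter_mulr_1. Qed.

Lemma cvg_poch_scaled (T : Type) (F : set_system T) (FF : Filter F)
    (x s : T -> R) L n :
  x t @[t --> F] --> 0 -> x t * s t @[t --> F] --> L ->
  x t ^+ n * poch (s t) n @[t --> F] --> L ^+ n.
Proof.
move=> x0 xs.
have -> : (fun t => x t ^+ n * poch (s t) n) =
    (fun t => \prod_(i < n) (x t * s t + x t * i%:R)).
  apply/funext => t; rewrite /poch expr_prod_ord -big_split /=.
  by apply: eq_bigr => i _; rewrite mulrDr.
rewrite expr_prod_ord.
apply: (@cvg_prodn _ _ _ FF n (fun i t => x t * s t + x t * i%:R)) => i.
rewrite -[L]addr0; apply: cvgD => //.
by rewrite -(mul0r i%:R); apply: cvgM => //; exact: cvg_cst.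
Qed.

Lemma cvg_ffactr_scaled (T : Type) (F : set_system T) (FF : Filter F)
    (x s : T -> R) L n :
  x t @[t --> F] --> 0 -> x t * s t @[t --> F] --> L ->
  x t ^+ n * ffactr (s t) n @[t --> F] --> L ^+ n.
Proof.
move=> x0 xs.
have -> : (fun t => x t ^+ n * ffactr (s t) n) =
    (fun t => \prod_(i < n) (x t * s t - x t * i%:R)).
  apply/funext => t; rewrite /ffactr expr_prod_ord -big_split /=.
  by apply: eq_bigr => i _; rewrite mulrBr.
rewrite expr_prod_ord.
apply: (@cvg_prodn _ _ _ FF n (fun i t => x t * s t - x t * i%:R)) => i.
rewrite -[L]subr0; apply: cvgB => //.
by rewrite -(mul0r i%:R); apply: cvgM => //; exact: cvg_cst.
Qed.

(** The factor is what remains of (nu + 1 + i) x / (1 + i) after using (nu + 1) x <= M and x <= 1/4.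
    It tends to 1/4, so the products decay geometrically. *)
Definition hyp_majorant M j : R := \prod_(i < j) ((M + i%:R / 4) / (1 + i%:R)).

Lemma is_cvg_hyp_majorant M : 0 <= M -> cvgn (series (hyp_majorant M)).
Proof.
move=> M0.
(* For i >= 4 M the factor is at most (i / 2) / (1 + i) <= 1/2. The earlier factors are at most M +
   1/2, that is [B] times 1/2. *)
pose J := Num.bound (4 * M).
have JM : 4 * M < J%:R by apply: archi_boundP; rewrite mulr_ge0.
pose B : R := 2 * M + 1.
have pos i : 0 < 1 + i%:R :> R by rewrite ltr_wpDr.
have r0 i : 0 <= (M + i%:R / 4) / (1 + i%:R).
  by rewrite divr_ge0 ?(ltW (pos _))// addr_ge0// divr_ge0.
have le i : hyp_majorant M i <= B ^+ J * (1 / 2) ^+ i.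
  have -> : (1 / 2) ^+ i = (1 / 2) ^+ i / (1 / 2) ^+ 0 :> R by rewrite expr0 divr1.
  apply: (@ratio_bound R (fun i => (M + i%:R / 4) / (1 + i%:R)) (fun i => (1 / 2) ^+ i)).
  - by rewrite /B; lra.
  - exact: r0.
  - by move=> n; apply: exprn_gt0; lra.
  - move=> n _; rewrite exprS.
    have w0 : 0 <= (1 / 2) ^+ n :> R by apply: exprn_ge0; lra.
    rewrite [X in _ <= X]mulrA ler_wpM2r// ler_pdivrMr//.
    have := ler0n R n; rewrite /B; nra.
  - move=> n Jn; have {}Jn : J%:R <= n%:R :> R by rewrite ler_nat.
    have w0 : 0 <= (1 / 2) ^+ n :> R by apply: exprn_ge0; lra.
    rewrite exprS ler_wpM2r// ler_pdivrMr//; lra.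
apply: series_le_cvg le _ => [i|i|].
- by apply: prodr_ge0.
- by apply: mulr_ge0; apply: exprn_ge0; rewrite /B; lra.
- apply: is_cvg_geometric_series; rewrite ger0_norm; lra.
Qed.

Lemma hyp_termE (a c x : R) j :
  poch 1 j * poch a j / poch c j * x ^+ j / j`!%:R =
  \prod_(i < j) ((a + i%:R) * x / (c + i%:R)).
Proof.
have f0 : j`!%:R != 0 :> R by rewrite pnatr_eq0 -lt0n fact_gt0.
rewrite poch1n; move: (_`!%:R) f0 => f f0.
have -> : f * poch a j / poch c j * x ^+ j / f = poch a j * x ^+ j * (poch c j)^-1.
  by move: (poch c j)^-1 => Q; field.
rewrite /poch -prodfV expr_prod_ord -!big_split /=.
by [].
Qed.

(** Uniformity in k and l: (nu + 1 + i) / (1 + i) is at least 1, and adding l to the numerator and k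
    + 1 >= l to the denominator can only lower it. *)
Lemma hyp_term_bound nu x M k l j : 0 <= nu -> 0 < x -> x <= 4^-1 ->
  (nu + 1) * x <= M -> (l <= k.+1)%N ->
  0 <= \prod_(i < j) ((l%:R + nu + 1 + i%:R) * x / (k.+2%:R + i%:R))
    <= hyp_majorant M j.
Proof.
move=> nu0 x0 x4 nM lk.
have lkR : l%:R <= k.+2%:R - 1 :> R.
  by rewrite -[k.+2]addn1 natrD addrK ler_nat.
have L0 := ler0n R l.
apply/andP; split.
  apply: prodr_ge0 => i _; have := ler0n R i => ?.
  by rewrite divr_ge0 ?mulr_ge0 ?addr_ge0// ltW.
apply: ler_prod => i _; have i0 := ler0n R i.
apply/andP; split; first by rewrite divr_ge0 ?mulr_ge0 ?addr_ge0// ltW.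
apply: (@le_trans _ _ ((nu + 1 + i%:R) * x / (1 + i%:R))); last first.
  by rewrite ler_pM2r ?invr_gt0 ?ltr_wpDr//; nra.
rewrite ler_pdivrMr; last by rewrite ltr_wpDr.
rewrite mulrAC ler_pdivlMr; last by lra.
rewrite mulrAC [leRHS]mulrAC ler_pM2r//.
have : 0 <= (nu + 1) * (k.+2%:R - l%:R - 1) by apply: mulr_ge0; lra.
have : 0 <= i%:R * (k.+2%:R - l%:R - 1) :> R by apply: mulr_ge0; lra.
nra.
Qed.

End pochhammer.

Section gtilde_estimates.
Context {R : realType}.
Implicit Types (nu x L M q alpha : R) (k l n j : nat).

Lemma hyp2F1_bounds nu x M k l : 0 <= nu -> 0 < x -> x <= 4^-1 ->
  (nu + 1) * x <= M -> (l <= k.+1)%N ->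
  1 <= hyp2F1 1 (l%:R + nu + 1) k.+2%:R x <= limn (series (hyp_majorant M)).
Proof.
move=> nu0 x0 x4 nM lk; rewrite /hyp2F1.
under eq_fun do rewrite hyp_termE.
set t := (fun j => _).
have tb j : 0 <= t j <= hyp_majorant M j by exact: hyp_term_bound.
have M0 : 0 <= M by apply: le_trans nM; apply: mulr_ge0; lra.
have cM := is_cvg_hyp_majorant M0.
have ct : cvgn (series t).
  apply: is_cvg_series_dominated cM _ => j.
  by have /andP[t0 tM] := tb j; rewrite ger0_norm.
apply/andP; split; last by apply: lim_series_le => // j; have /andP[] := tb j.
have -> : 1 = series t 1%N by rewrite /series /= big_nat1 /t big_ord0.
apply: nondecreasing_cvgn_le => //; apply: nondecreasing_series => j _ _.
by have /andP[] := tb j.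
Qed.

Lemma gtilde_norm_le nu x M k l : 0 < nu -> 0 < x -> x <= 4^-1 ->
  (nu + 1) * x <= M -> (l <= k)%N ->
  `|gtilde k l (1 - x) nu| <= limn (series (hyp_majorant M)) / k.+1%:R
     * (poch (nu + 1) l * poch (nu + 1) (k - l)).
Proof.
move=> nu0 x0 x4 nM lk.
have /andP[hk1 hkM] := hyp2F1_bounds (ltW nu0) x0 x4 nM (leqW lk).
have /andP[h01 h0M] := hyp2F1_bounds (ltW nu0) x0 x4 nM (leq0n 1).
rewrite /gtilde /reg2F1 ffactr_split//.
rewrite subKr add0r in h01 h0M *.
move: hk1 hkM h01 h0M; set hk := hyp2F1 _ _ _ _; set h0 := hyp2F1 _ _ _ _.
set S := limn _ => hk1 hkM h01 h0M.
rewrite /= divr1 [nu * _]mulrC mulfK ?gt_eqF// factS natrM.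
have f0 : 0 < k`!%:R :> R by rewrite ltr0n fact_gt0.
have p0 : 0 < poch (nu + 1) l by apply: poch_gt0; lra.
(* The quotient k! / (k + 1)! leaves the factor 1 / (k + 1), on which the final summability rests.
   Dividing by [h0] is harmless since it is at least its zeroth term, 1. *)
have -> : k`!%:R * (poch (nu + 1) l * ffactr (nu - 1) (k - l)) *
   (hk / (k.+1%:R * k`!%:R) / h0) =
   (hk / h0) / k.+1%:R * (poch (nu + 1) l * ffactr (nu - 1) (k - l)).
  by field; rewrite !gt_eqF//; lra.
have hk0 : 0 <= hk / h0 by apply: divr_ge0; lra.
have hk0' : 0 <= hk / h0 / k.+1%:R by rewrite divr_ge0.
rewrite (normrM (hk / h0 / _)) (normrM (poch _ _)) (ger0_norm hk0') (gtr0_norm p0).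
apply: ler_pM.
- by [].
- by rewrite mulr_ge0// ltW.
- rewrite ler_wpM2r ?invr_ge0// ler_pdivrMr; nra.
- by rewrite ler_wpM2l ?(ltW p0)// ffactr_norm_le// ltW.
Qed.

(** The confluent function 1F1(1; k + 2; L). *)
Definition hyp_limit L k : R := limn (series (fun j => \prod_(i < j) (L / (k.+2%:R + i%:R)))).

Definition glimit L k : R := k`!%:R * L ^+ k * (hyp_limit L k / k.+1`!%:R / hyp_limit L 0).

Section filter_limits.
Variables (T : Type) (F : set_system T) (FF : ProperFilter F) (x nu : T -> R) (L M : R).
Hypotheses (x0 : x t @[t --> F] --> 0) (xnu : x t * nu t @[t --> F] --> L).
Hypothesis bounds : \forall t \near F,
  [/\ 0 < nu t, 0 < x t, x t <= 4^-1 & (nu t + 1) * x t <= M].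

Let xnuD (a : R) : x t * (nu t + a) @[t --> F] --> L.
Proof.
under eq_fun do rewrite mulrDr.
rewrite -[L]addr0; apply: cvgD => //; rewrite -(mul0r a); apply: cvgM => //.
exact: cvg_cst.
Qed.

Lemma cvg_hyp2F1 k l : (l <= k.+1)%N ->
  hyp2F1 1 (l%:R + nu t + 1) k.+2%:R (x t) @[t --> F] --> hyp_limit L k.
Proof.
move=> lk; rewrite /hyp2F1 /hyp_limit.
under eq_fun do under eq_fun do rewrite hyp_termE.
have M0 : 0 <= M.
  have [t [nu0 xt0 _ nM]] := filter_ex bounds.
  by apply: le_trans nM; apply: mulr_ge0; lra.
apply: (@tannery _ _ _ FF (fun j t =>
    \prod_(i < j) ((l%:R + nu t + 1 + i%:R) * x t / (k.+2%:R + i%:R)))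
  _ _ (is_cvg_hyp_majorant M0)).
  move=> j; apply: (@cvg_prodn _ _ _ _ j
    (fun i t => (l%:R + nu t + 1 + i%:R) * x t / (k.+2%:R + i%:R))
    (fun i => L / (k.+2%:R + i%:R))).
  move=> i; apply: cvgM; last exact: cvg_cst.
  have -> : (fun t => (l%:R + nu t + 1 + i%:R) * x t) =
      (fun t => x t * (nu t + (l%:R + 1 + i%:R))) by apply/funext => t; ring.
  exact: xnuD.
apply: filterS bounds => t [nu0 xt0 x4 nM] j.
have /andP[h0 hM] := hyp_term_bound j (ltW nu0) xt0 x4 nM lk.
by rewrite ger0_norm.
Qed.

Lemma cvg_gtilde k l : (l <= k)%N -> hyp_limit L 0 != 0 ->
  x t ^+ k * gtilde k l (1 - x t) (nu t) @[t --> F] --> glimit L k.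
Proof.
move=> lk h0.
(* The power x^k is shared out as x^l for the rising product and x^(k-l) for the falling one. Each
   scaled factor tends to L, so the position l leaves no trace in the limit. *)
have E : \forall t \near F,
   k`!%:R * ((x t ^+ l * poch (nu t + 1) l) * (x t ^+ (k - l) * ffactr (nu t - 1) (k - l)))
   * (hyp2F1 1 (l%:R + nu t + 1) k.+2%:R (x t) / k.+1`!%:R / hyp2F1 1 (0%:R + nu t + 1) 2 (x t))
   = x t ^+ k * gtilde k l (1 - x t) (nu t).
  apply: filterS bounds => t [nu0 xt0 x4 nM].
  rewrite /gtilde /reg2F1 ffactr_split// subKr add0r /= divr1;
  rewrite [nu t * _]mulrC mulfK ?gt_eqF// -[in x t ^+ k](subnKC lk) exprD.
  by move: (_ / _ / _) => Q; ring.
apply: cvg_trans (near_eq_cvg E) _.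
rewrite /glimit -(subnKC lk) exprD subnKC//.
apply: cvgM.
  apply: cvgM; first exact: cvg_cst.
  by apply: cvgM; [exact: cvg_poch_scaled|exact: cvg_ffactr_scaled].
apply: cvgM; first by apply: cvgM; [exact: cvg_hyp2F1 (leqW lk)|exact: cvg_cst].
by apply: cvgV => //; exact: cvg_hyp2F1.
Qed.

End filter_limits.

(* With [n = nu + 1 = O(1/x)] and [alpha] of order [x ^- 2], the left-hand side
   is the general term of 2F1(n, n; alpha; 1); Raabe's test applies uniformly
   in [x]. *)
Lemma poch_ratio_bound (q : R) : 0 < q -> exists U : R, forall n alpha : R,
  0 < n -> n ^+ 2 <= q * alpha -> 4 * n <= alpha -> forall l,
  poch n l ^+ 2 / (poch alpha l * l`!%:R) <= U / l.+1%:R.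
Proof.
move=> q0; pose J := Num.bound (4 * q).
have JM : 4 * q < J%:R by apply: archi_boundP; rewrite mulr_ge0// ltW.
pose B := 4 * (q + J%:R) + 1.
exists (B ^+ J) => n alpha n0 nq n4 l.
have a0 : 0 < alpha by lra.
have -> : poch n l ^+ 2 / (poch alpha l * l`!%:R) =
    \prod_(i < l) ((n + i%:R) ^+ 2 / ((alpha + i%:R) * (1 + i%:R))).
  by rewrite -poch1n /poch -prodrXl -big_split /= -prodfV -big_split.
have B1 : 1 <= B by rewrite /B lerDr mulr_ge0// addr_ge0// ltW.
have B0 : 0 <= B by lra.
have pos i : 0 < (alpha + i%:R) * (1 + i%:R) by rewrite mulr_gt0// ltr_wpDr.
have -> : B ^+ J / l.+1%:R = B ^+ J * (l.+1%:R^-1 / 1%N%:R^-1).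
  by rewrite invr1 divr1.
apply: (@ratio_bound R (fun i => (n + i%:R) ^+ 2 / ((alpha + i%:R) * (1 + i%:R)))
  (fun i => i.+1%:R^-1)).
- exact: B1.
- by move=> i; rewrite divr_ge0 ?sqr_ge0// ltW.
- by move=> i; rewrite invr_gt0.
- move=> i iJ; rewrite ler_pdivlMr// mulrAC ler_pdivrMr// mulrAC ler_pdivrMr//.
  have {}iJ : i%:R <= J%:R - 1 :> R by rewrite lerBrDr natr1 ler_nat.
  have i0 := ler0n R i.
  rewrite -2!natr1 [B * _]mulrC.
  (* Early factors: (n + i)^2 <= 2 n^2 + 2 i^2 with n^2 <= q alpha. The value of [B] comes from
     here. *)
  have h1 : (n + i%:R) ^+ 2 <= 2 * (q + i%:R) * (alpha + i%:R).
    have := sqr_ge0 (n - i%:R). have : 0 <= q * i%:R by rewrite mulr_ge0// ltW.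
    have : 0 <= alpha * i%:R by rewrite mulr_ge0// ltW.
    nra.
  have h2 : 2 * (q + i%:R) * (i%:R + 1 + 1) <= B * (1 + i%:R) * (i%:R + 1).
    have : 2 * (q + i%:R) * (i%:R + 1 + 1) <= B * (i%:R + 1).
      rewrite /B; nra.
    have : 0 <= B * (i%:R + 1) * i%:R.
      by apply: mulr_ge0 => //; apply: mulr_ge0 => //; apply: addr_ge0.
    nra.
  have a1 : 0 <= alpha + i%:R by rewrite addr_ge0// ltW.
  have := ler_wpM2r a1 h2.
  have i2 : 0 <= i%:R + 1 + 1 :> R by rewrite !addr_ge0.
  have := ler_wpM2r i2 h1.
  nra.
- move=> i Ji; rewrite ler_pdivrMr// ler_pdivrMr// -mulrA ler_pdivlMl//.
  have {}Ji : J%:R <= i%:R :> R by rewrite ler_nat.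
  have i0 := ler0n R i.
  rewrite -2!natr1.
  (* Since i >= 4 q, n^2 takes at most a quarter of i alpha, and 2 n i at most a half of it. The
     comparison with the weight 1 / (i + 1) then reduces to i (i + 2) <= (i + 1)^2. *)
  have h1 : (n + i%:R) ^+ 2 <= i%:R * (alpha + i%:R).
    have : 4 * q * alpha <= i%:R * alpha by rewrite ler_wpM2r ?(ltW a0)//; lra.
    have : 4 * n * i%:R <= alpha * i%:R by rewrite ler_wpM2r.
    nra.
  have i2 : 0 <= i%:R + 1 + 1 :> R by rewrite !addr_ge0.
  have := ler_wpM2l i2 h1.
  nra.
Qed.

End gtilde_estimates.

(** * Terms of the squared coefficient of variation *)

Section acv_terms.
Context {R : realType}.
Implicit Types (nu x z v M q U a n m : R) (k l : nat).

Lemma cvg_series_inv_sqr : cvgn (series (fun k => (k.+1%:R ^+ 2)^-1 : R)).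
Proof.
have le k : \sum_(0 <= i < k.+1) (i.+1%:R ^+ 2)^-1 <= 2 - k.+1%:R^-1 :> R.
  elim: k => [|k ih]; first by rewrite big_nat1 expr1n invr1; lra.
  rewrite big_nat_recr //=; apply: le_trans (lerD ih (lexx _)) _.
  have k0 := ler0n R k; rewrite -[k.+2%:R]natr1 -[k.+1%:R]natr1.
  move: (k%:R : R) k0 => r r0.
  rewrite -subr_ge0.
  have -> : 2 - (r + 1 + 1)^-1 - (2 - (r + 1)^-1 + ((r + 1 + 1) ^+ 2)^-1) =
     ((r + 1) * (r + 1 + 1) ^+ 2)^-1 :> R.
    by field; apply/andP; split; rewrite gt_eqF//; lra.
  by rewrite invr_ge0 mulr_ge0 ?sqr_ge0//; lra.
apply: nondecreasing_is_cvgn.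
  by apply: nondecreasing_series => k _ _; rewrite invr_ge0 sqr_ge0.
exists 2 => _ [[|k] _ <-]; first by rewrite /series /= big_nil.
by apply: le_trans (le k) _; rewrite gerBl.
Qed.

(** The binomial theorem divided by k!. With [b1], [b2] the reciprocals of the scaled shapes, it
    collapses the inner sum over l, which is how the two sizes merge into one variable s. *)
Lemma sum_binomial_fact (b1 b2 : R) k :
  \sum_(l < k.+1) b1 ^+ l * b2 ^+ (k - l) / (l`!%:R * (k - l)`!%:R) =
  (b1 + b2) ^+ k / k`!%:R.
Proof.
rewrite addrC exprDn mulr_suml; apply: eq_bigr => [[l lk] _] /=.
rewrite ltnS in lk.
rewrite -(bin_fact lk) !natrM -mulr_natr.
have f i : i`!%:R != 0 :> R by rewrite pnatr_eq0 -lt0n fact_gt0.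
have c : 'C(k, l)%:R != 0 :> R by rewrite pnatr_eq0 -lt0n bin_gt0.
by field; rewrite !f c.
Qed.

Definition acv_term n1 n2 z nu k : R :=
  \sum_(l < k.+1) gtilde k l z nu ^+ 2 /
     (poch (Defs.shape n1) l * poch (Defs.shape n2) (k - l) * l`!%:R * (k - l)`!%:R).

Lemma shape_gt0 n : 1 < n -> 0 < Defs.shape n.
Proof. by move=> n1; rewrite /Defs.shape divr_gt0// subr_gt0. Qed.

Lemma acv_denom_gt0 n1 n2 l j : 1 < n1 -> 1 < n2 ->
  0 < poch (Defs.shape n1) l * poch (Defs.shape n2) j * l`!%:R * j`!%:R.
Proof.
move=> h1 h2; have f i : 0 < i`!%:R :> R by rewrite ltr0n fact_gt0.
by rewrite !mulr_gt0// poch_gt0// shape_gt0.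
Qed.

Lemma acv_term_ge0 n1 n2 z nu k : 1 < n1 -> 1 < n2 -> 0 <= acv_term n1 n2 z nu k.
Proof.
move=> h1 h2; apply: sumr_ge0 => l _.
by rewrite divr_ge0 ?sqr_ge0// ltW// acv_denom_gt0.
Qed.

(** Requires no convergence, so it also covers sizes for which [ACV2] is infinite. *)
Lemma ACV2_gt_partial n1 n2 z nu v K : 1 < n1 -> 1 < n2 ->
  v < \sum_(k < K) acv_term n1 n2 z nu k.+1 -> (v%:E < ACV2 n1 n2 z nu)%E.
Proof.
move=> h1 h2; rewrite -(big_mkord xpredT (fun k => acv_term n1 n2 z nu k.+1)).
rewrite -(big_add1 _ _ 0 K.+1 xpredT (acv_term n1 n2 z nu)) => vs.
apply: (@lt_le_trans _ _ (\sum_(1 <= k < K.+1) acv_term n1 n2 z nu k)%:E).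
  by rewrite lte_fin.
rewrite -sumEFin; apply: nneseries_lim_ge => k _ _.
by rewrite lee_fin; exact: acv_term_ge0.
Qed.

Lemma ACV2_ge0 n1 n2 z nu : 1 < n1 -> 1 < n2 -> (0 <= ACV2 n1 n2 z nu)%E.
Proof.
by move=> h1 h2; apply: nneseries_ge0 => k _ _; rewrite lee_fin; exact: acv_term_ge0.
Qed.

Definition acv_sum n1 n2 z nu : R := limn (series (fun k => acv_term n1 n2 z nu k.+1)).

Lemma ACV2_fin n1 n2 z nu : 1 < n1 -> 1 < n2 ->
  cvgn (series (fun k => acv_term n1 n2 z nu k.+1)) ->
  ACV2 n1 n2 z nu = (acv_sum n1 n2 z nu)%:E.
Proof.
move=> h1 h2 cs; rewrite /ACV2.
rewrite -(@nneseries_addn _ (fun k => (acv_term n1 n2 z nu k)%:E)); last first.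
  by move=> k; rewrite lee_fin; exact: acv_term_ge0.
rewrite /acv_sum -EFin_lim//; congr (limn _); apply/funext => k /=.
by rewrite /series /= -sumEFin; apply: eq_bigr => i _; rewrite addn1.
Qed.

Definition acv_majorant M U k : R :=
  (limn (series (hyp_majorant M)) * U) ^+ 2 / k.+1%:R ^+ 2.

Lemma is_cvg_acv_majorant M U : cvgn (series (acv_majorant M U)).
Proof. exact: (is_cvg_seriesZ cvg_series_inv_sqr). Qed.

(** Each of the two Pochhammer quotients contributes U / (l + 1) or U / (k - l + 1). Their product
    is at most U^2 / (k + 1), which absorbs the k + 1 summands, and the factor 1 / (k + 1)^2 from
    [gtilde] survives. The bound defining [U] is taken as a hypothesis so that [U] depends on [q]
    alone and is fixed before nu, x and the sizes. *)
Lemma acv_term_le nu x M q U n1 n2 k :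
  (forall n alpha : R, 0 < n -> n ^+ 2 <= q * alpha -> 4 * n <= alpha -> forall l,
    poch n l ^+ 2 / (poch alpha l * l`!%:R) <= U / l.+1%:R) ->
  0 < nu -> 0 < x -> x <= 4^-1 -> (nu + 1) * x <= M -> 1 < n1 -> 1 < n2 ->
  (nu + 1) ^+ 2 <= q * Defs.shape n1 -> 4 * (nu + 1) <= Defs.shape n1 ->
  (nu + 1) ^+ 2 <= q * Defs.shape n2 -> 4 * (nu + 1) <= Defs.shape n2 ->
  acv_term n1 n2 (1 - x) nu k <= acv_majorant M U k.
Proof.
move=> HU nu0 x0 x4 nM h1 h2 q1 r1 q2 r2; rewrite /acv_majorant.
have := fun l => @gtilde_norm_le R nu x M k l nu0 x0 x4 nM.
set S := limn _ => gS.
have nu1 : 0 < nu + 1 by lra.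
have U1 := HU _ _ nu1 q1 r1; have U2 := HU _ _ nu1 q2 r2.
have kk : 0 < k.+1%:R :> R by rewrite ltr0n.
apply: (@le_trans _ _ (\sum_(l < k.+1) ((S * U) ^+ 2 / k.+1%:R ^+ 2 / k.+1%:R))); last first.
  by rewrite sumr_const card_ord -(mulr_natr (_ / _)) divfK// gt_eqF.
apply: ler_sum => [[l lk] _] /=; rewrite ltnS in lk.
have f i : 0 < i`!%:R :> R by rewrite ltr0n fact_gt0.
have p1 := poch_gt0 l (shape_gt0 h1); have p2 := poch_gt0 (k - l) (shape_gt0 h2).
set P1 := poch (nu + 1) l; set P2 := poch (nu + 1) (k - l).
have d0 := acv_denom_gt0 l (k - l) h1 h2.
apply: (@le_trans _ _ ((S / k.+1%:R * (P1 * P2)) ^+ 2 /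
   (poch (Defs.shape n1) l * poch (Defs.shape n2) (k - l) * l`!%:R * (k - l)`!%:R))).
  rewrite ler_wpM2r ?invr_ge0 ?(ltW d0)// -(real_normK (num_real (gtilde _ _ _ _))).
  rewrite lerXn2r ?nnegrE//.
    exact: le_trans (gS _ lk).
  exact: gS.
have -> : (S / k.+1%:R * (P1 * P2)) ^+ 2 /
   (poch (Defs.shape n1) l * poch (Defs.shape n2) (k - l) * l`!%:R * (k - l)`!%:R) =
   (S / k.+1%:R) ^+ 2 * ((P1 ^+ 2 / (poch (Defs.shape n1) l * l`!%:R)) *
     (P2 ^+ 2 / (poch (Defs.shape n2) (k - l) * (k - l)`!%:R))).
  by field; rewrite !gt_eqF.
have -> : (S * U) ^+ 2 / k.+1%:R ^+ 2 / k.+1%:R = (S / k.+1%:R) ^+ 2 * (U ^+ 2 / k.+1%:R).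
  by field; rewrite !gt_eqF.
rewrite ler_wpM2l ?sqr_ge0//.
apply: (@le_trans _ _ (U / l.+1%:R * (U / (k - l).+1%:R))).
  apply: ler_pM; [| |exact: U1|exact: U2].
  - by rewrite divr_ge0 ?sqr_ge0// mulr_ge0// ltW.
  - by rewrite divr_ge0 ?sqr_ge0// mulr_ge0// ltW.
rewrite mulf_div -expr2 ler_wpM2l ?sqr_ge0// lef_pV2 ?posrE ?mulr_gt0//.
(* This is k + 1 <= (l + 1) (k - l + 1). *)
rewrite -natrM ler_nat mulSn mulnS; move: (l * _)%N => j; clear -lk.
by rewrite addnA addSn subnK// ltnS leq_addr.
Qed.

End acv_terms.

(** * The limiting series *)

Section acv_limit.
Context {R : realType}.
Implicit Types (L s c v : R) (k l : nat).

Definition acv_limit_term L s k : R := glimit L k ^+ 2 * s ^+ k / k`!%:R.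

Definition acv_limit L s : R := limn (series (fun k => acv_limit_term L s k.+1)).

Lemma hyp_limit_bounds L k : 0 < L -> 1 <= hyp_limit L k <= hyp_limit L 0.
Proof.
move=> L0.
have pos k' i : 0 < k'.+2%:R + i%:R :> R by rewrite ltr_wpDr.
have t0 k' j : 0 <= \prod_(i < j) (L / (k'.+2%:R + i%:R)) :> R.
  by apply: prodr_ge0 => i _; rewrite divr_ge0 ?(ltW L0)// ltW.
have le0 k' j : \prod_(i < j) (L / (k'.+2%:R + i%:R)) <= \prod_(i < j) (L / (2%:R + i%:R)) :> R.
  apply: ler_prod => i _; rewrite divr_ge0 ?(ltW L0) ?(ltW (pos _ _))//=.
  by rewrite ler_pM2l// lef_pV2 ?posrE ?(pos _ _) ?(pos 0%N)// lerD2r ler_nat.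
have ct k' : cvgn (series (fun j => \prod_(i < j) (L / (k'.+2%:R + i%:R)))).
  apply: is_cvg_series_dominated (is_cvg_hyp_majorant (ltW L0)) _ => j.
  rewrite ger0_norm//; apply: le_trans (le0 k' j) _.
  apply: ler_prod => i _; rewrite divr_ge0 ?(ltW L0) ?(ltW (pos 0%N _))//=.
  have i0 := ler0n R i.
  apply: ler_pM; [exact: ltW|by rewrite invr_ge0; lra|lra|].
  by rewrite lef_pV2 ?posrE; lra.
apply/andP; split; last exact: lim_series_le.
rewrite /hyp_limit; set t := (fun j => _).
have -> : 1 = series t 1%N by rewrite /series /= big_nat1 /t big_ord0.
by apply: nondecreasing_cvgn_le (ct k) _; apply: nondecreasing_series => j _ _; exact: t0.
Qed.

Lemma glimit_gt0 L k : 0 < L -> 0 < glimit L k.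
Proof.
move=> L0; have /andP[h1 _] := hyp_limit_bounds k L0.
have /andP[h0 _] := hyp_limit_bounds 0 L0.
have f i : 0 < i`!%:R :> R by rewrite ltr0n fact_gt0.
have hk : 0 < hyp_limit L k by lra.
have h0' : 0 < hyp_limit L 0 by exact: lt_le_trans ltr01 h0.
by rewrite /glimit !mulr_gt0 ?invr_gt0 ?exprn_gt0.
Qed.

Lemma glimit_le L k : 0 < L -> glimit L k <= L ^+ k.
Proof.
move=> L0; have /andP[h1 hk] := hyp_limit_bounds k L0.
have /andP[h0 _] := hyp_limit_bounds 0 L0.
have f i : 0 < i`!%:R :> R by rewrite ltr0n fact_gt0.
have Lk : 0 < L ^+ k by exact: exprn_gt0.
have h0' : 0 < hyp_limit L 0 by exact: lt_le_trans ltr01 h0.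
have -> : glimit L k = L ^+ k * (hyp_limit L k / hyp_limit L 0 / k.+1%:R).
  rewrite /glimit factS natrM; field.
  by rewrite !gt_eqF.
rewrite ger_pMr// ler_pdivrMr// mul1r ler_pdivrMr//.
have : 1 <= k.+1%:R :> R by rewrite ler1n.
nra.
Qed.

Lemma acv_limit_term_gt0 L s k : 0 < L -> 0 < s -> 0 < acv_limit_term L s k.
Proof.
move=> L0 s0; rewrite /acv_limit_term divr_gt0 ?ltr0n ?fact_gt0// mulr_gt0//.
  by rewrite exprn_gt0// glimit_gt0.
exact: exprn_gt0.
Qed.

Lemma acv_limit_term_le L s k : 0 < L -> 0 <= s ->
  `|acv_limit_term L s k| <= exp_coeff (L ^+ 2 * s) k.
Proof.
move=> L0 s0; have g0 := glimit_gt0 k L0.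
rewrite /acv_limit_term ger0_norm; last first.
  by rewrite divr_ge0// mulr_ge0 ?sqr_ge0// exprn_ge0.
rewrite /exp_coeff /= [(L ^+ 2 * s) ^+ k]exprMn.
rewrite ler_wpM2r ?invr_ge0// ler_wpM2r ?exprn_ge0//.
by rewrite -exprM mulnC exprM lerXn2r ?nnegrE ?(ltW g0) ?exprn_ge0 ?(ltW L0)// glimit_le.
Qed.

Lemma cvg_series_shift (u : R ^nat) : cvgn (series u) ->
  series (fun k => u k.+1) n @[n --> \oo] --> limn (series u) - u 0%N.
Proof.
move=> cu; have cu1 : series u n.+1 @[n --> \oo] --> limn (series u).
  by move: cu; rewrite -(cvg_shiftS (series u)).
have -> : series (fun k => u k.+1) = (fun n => series u n.+1 - u 0%N).
  by apply/funext => n; rewrite /series /= big_nat_recl// addrC addKr.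
by apply: cvgB => //; exact: cvg_cst.
Qed.

Lemma is_cvg_series_shift (u : R ^nat) : cvgn (series u) -> cvgn (series (fun k => u k.+1)).
Proof. by move=> /cvg_series_shift; apply: cvgP. Qed.

Lemma is_cvg_acv_limit L s : 0 < L -> 0 <= s ->
  cvgn (series (fun k => acv_limit_term L s k.+1)).
Proof.
move=> L0 s0; apply: is_cvg_series_dominated => [|k].
  exact: is_cvg_series_shift (is_cvg_series_exp_coeff (L ^+ 2 * s)).
exact: acv_limit_term_le.
Qed.

Lemma cvg_acv_limit (T : Type) (F : set_system T) (FF : ProperFilter F)
    (s : T -> R) L s0 : 0 < L -> 0 <= s0 -> (\forall t \near F, 0 <= s t) ->
  s t @[t --> F] --> s0 -> acv_limit L (s t) @[t --> F] --> acv_limit L s0.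
Proof.
move=> L0 s00 sF ss.
have := is_cvg_series_shift (is_cvg_series_exp_coeff (L ^+ 2 * (s0 + 1))).
move=> /(@tannery _ _ _ FF (fun k t => acv_limit_term L (s t) k.+1)); apply.
  move=> k; apply: cvgM; last exact: cvg_cst.
  by apply: cvgM; [exact: cvg_cst|exact: cvg_exprn].
near=> t => k.
have st : 0 <= s t by near: t.
have st1 : s t <= s0 + 1.
  by near: t; apply: cvgr_le ss _ _; rewrite ltrDl.
apply: le_trans (acv_limit_term_le _ L0 st) _.
rewrite /exp_coeff /= ler_wpM2r ?invr_ge0//.
have L2 : 0 <= L ^+ 2 by exact: sqr_ge0.
apply: lerXn2r; rewrite ?nnegrE.
- exact: mulr_ge0.
- by apply: mulr_ge0 => //; lra.
- exact: ler_wpM2l.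
Unshelve. all: by end_near. Qed.

(** Let p(a, b) be the inverse of 1/a + 1/b. Raising both arguments by e raises p by at most e, and
    the hypothesis says p(a1, a2) <= 1/s. *)
Lemma harmonic_sum_ge (a1 a2 e s : R) : 0 < a1 -> 0 < a2 -> 0 <= e -> 0 < s ->
  s <= a1^-1 + a2^-1 -> (s^-1 + e)^-1 <= (a1 + e)^-1 + (a2 + e)^-1.
Proof.
move=> a10 a20 e0 s0 sa.
have -> : (a1 + e)^-1 + (a2 + e)^-1 = ((a1 + e) * (a2 + e) / (a1 + a2 + 2 * e))^-1.
  by field; rewrite !gt_eqF//; lra.
have p : 0 < (a1 + e) * (a2 + e) / (a1 + a2 + 2 * e).
  by rewrite divr_gt0 ?mulr_gt0//; lra.
have si : 0 < s^-1 by rewrite invr_gt0.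
rewrite lef_pV2 ?posrE//; last by lra.
have h : a1 * a2 / (a1 + a2) <= s^-1.
  have -> : a1 * a2 / (a1 + a2) = (a1^-1 + a2^-1)^-1 by field; rewrite !gt_eqF//; lra.
  by rewrite lef_pV2 ?posrE// addr_gt0// invr_gt0.
apply: (@le_trans _ _ (a1 * a2 / (a1 + a2) + e)); last by lra.
rewrite ler_pdivrMr; last by lra.
have -> : (a1 * a2 / (a1 + a2) + e) * (a1 + a2 + 2 * e) =
  (a1 + e) * (a2 + e) + (e ^+ 2 * (a1 + a2) + 2 * a1 * a2 * e) / (a1 + a2).
  by field; rewrite gt_eqF//; lra.
rewrite lerDl divr_ge0//; last by lra.
by rewrite addr_ge0// ?mulr_ge0 ?sqr_ge0 ?(ltW a10) ?(ltW a20)//; lra.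
Qed.

Lemma poch_le_expr (a : R) l K : 0 <= a -> (l <= K)%N -> poch a l <= (a + K%:R) ^+ l.
Proof.
move=> a0 lK; rewrite expr_prod_ord; apply: ler_prod => i _.
by rewrite addr_ge0//= lerD2l ler_nat; apply: leq_trans lK; apply: ltnW.
Qed.

(** The left side depends on the sizes only through the lower bound on 2 / n1 + 2 / n2. Each
    (alpha)_j is at most (n / 2 + K)^j, the binomial theorem sums over l, and [harmonic_sum_ge]
    moves the shift [e] from the two sizes onto 1 / [s0]. *)
Lemma acv_term_lower (n1 n2 s0 X nu0 g : R) (k K : nat) :
  1 < n1 -> 1 < n2 -> 0 < X -> 0 < s0 -> 0 <= g -> (k <= K)%N ->
  s0 * X ^+ 2 <= 2 / n1 + 2 / n2 ->
  (forall l, (l <= k)%N -> g <= (X ^+ k * gtilde k l (1 - X) nu0) ^+ 2) ->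
  g * (s0^-1 + K%:R * X ^+ 2)^-1 ^+ k / k`!%:R <= acv_term n1 n2 (1 - X) nu0 k.
Proof.
move=> h1 h2 X0 s00 g0 kK sn gP.
have X2 : 0 < X ^+ 2 by exact: exprn_gt0.
pose a1 := X ^+ 2 * (n1 / 2); pose a2 := X ^+ 2 * (n2 / 2); pose e := K%:R * X ^+ 2.
have a10 : 0 < a1 by rewrite mulr_gt0//; lra.
have a20 : 0 < a2 by rewrite mulr_gt0//; lra.
have e0 : 0 <= e by rewrite mulr_ge0// ltW.
have h := @harmonic_sum_ge a1 a2 e s0 a10 a20 e0 s00.
have {}h : (s0^-1 + e)^-1 <= (a1 + e)^-1 + (a2 + e)^-1.
  apply: h; rewrite -(ler_pM2r X2); apply: le_trans sn _.
  rewrite /a1 /a2 le_eqVlt; apply/orP; left; apply/eqP; field.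
  by rewrite !gt_eqF//; lra.
have f i : 0 < i`!%:R :> R by rewrite ltr0n fact_gt0.
apply: (@le_trans _ _ (g * (((a1 + e)^-1 + (a2 + e)^-1) ^+ k / k`!%:R))).
  rewrite -mulrA ler_wpM2l// ler_wpM2r ?invr_ge0// lerXn2r// ?nnegrE.
  - by rewrite invr_ge0 addr_ge0// invr_ge0 ltW.
  - by rewrite addr_ge0// invr_ge0 addr_ge0// ltW.
rewrite -sum_binomial_fact mulr_sumr; apply: ler_sum => [[l lk] _] /=.
rewrite ltnS in lk.
have pb n j : 1 < n -> (j <= k)%N ->
    X ^+ 2 ^+ j * poch (Defs.shape n) j <= (X ^+ 2 * (n / 2) + e) ^+ j.
  move=> n1' jk; apply: (@le_trans _ _ ((X ^+ 2) ^+ j * (n / 2 + K%:R) ^+ j)).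
    rewrite ler_pM2l ?exprn_gt0//.
    apply: le_trans (poch_le_expr (ltW (shape_gt0 n1')) (leq_trans jk kK)) _.
    have K0 := ler0n R K.
    by rewrite lerXn2r// ?nnegrE /Defs.shape; lra.
  by rewrite -exprMn /e mulrDr [K%:R * _]mulrC.
have P1 := poch_gt0 l (shape_gt0 h1); have P2 := poch_gt0 (k - l) (shape_gt0 h2).
have b1 := pb _ _ h1 lk; have b2 := pb _ _ h2 (leq_subr l k).
rewrite -/a1 in b1; rewrite -/a2 in b2.
have -> : gtilde k l (1 - X) nu0 ^+ 2 /
   (poch (Defs.shape n1) l * poch (Defs.shape n2) (k - l) * l`!%:R * (k - l)`!%:R)
  = (X ^+ k * gtilde k l (1 - X) nu0) ^+ 2 * ((X ^+ 2 ^+ l * poch (Defs.shape n1) l)^-1 *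
     (X ^+ 2 ^+ (k - l) * poch (Defs.shape n2) (k - l))^-1 / (l`!%:R * (k - l)`!%:R)).
  have -> : X ^+ k = X ^+ l * X ^+ (k - l) by rewrite -exprD subnKC.
  move: (gtilde _ _ _ _) => G; rewrite -![X ^+ 2 ^+ _]exprM ![(2 * _)%N]mulnC !exprM.
  by field; rewrite !gt_eqF// ?exprn_gt0.
apply: ler_pM => //.
- rewrite divr_ge0 ?mulr_ge0 ?exprn_ge0// invr_ge0 addr_ge0// ltW//.
- exact: gP.
rewrite ler_wpM2r ?invr_ge0 ?mulr_ge0//.
rewrite !exprVn; apply: ler_pM; rewrite ?invr_ge0 ?exprn_ge0 ?addr_ge0 ?(ltW a10) ?(ltW a20)//.
- by rewrite lef_pV2 ?posrE// ?mulr_gt0 ?exprn_gt0// ltr_wpDr.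
- by rewrite lef_pV2 ?posrE// ?mulr_gt0 ?exprn_gt0// ltr_wpDr.
Qed.

End acv_limit.

(** * Asymptotics of the squared coefficient of variation *)

Section acv_asymptotics.
Context {R : realType}.
Variables (T : Type) (F : set_system T) (FF : ProperFilter F) (x nu : T -> R) (L M : R).
Hypotheses (x0 : x t @[t --> F] --> 0) (xnu : x t * nu t @[t --> F] --> L).
Hypothesis bounds : \forall t \near F,
  [/\ 0 < nu t, 0 < x t, x t <= 4^-1 & (nu t + 1) * x t <= M].
Hypothesis L_gt0 : 0 < L.

Let hyp_limit_neq0 : hyp_limit L 0 != 0.
Proof.
have /andP[h0 _] := hyp_limit_bounds 0 L_gt0.
by rewrite gt_eqF// (lt_le_trans ltr01 h0).
Qed.

Let M_gt0 : 0 < M.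
Proof.
have [t [nu0 xt0 _ nM]] := filter_ex bounds.
by apply: lt_le_trans nM; apply: mulr_gt0; lra.
Qed.

Let cvg_inv_add (s0 : R) (K : nat) : 0 < s0 ->
  (s0^-1 + K%:R * x t ^+ 2)^-1 @[t --> F] --> s0.
Proof.
move=> s00; rewrite -[X in _ --> X]invrK; apply: cvgV; first by rewrite invr_eq0 gt_eqF.
rewrite -[X in _ --> X]addr0; apply: cvgD; first exact: cvg_cst.
rewrite -(mulr0 K%:R); apply: cvgM; first exact: cvg_cst.
by rewrite -[X in _ --> X](expr0n R 2); exact: cvg_exprn.
Qed.

(* Fatou: only finitely many terms matter, and for each of them replacing
   [(alpha)_l] by [(alpha + K) ^+ l] costs [O(x ^+ 2)] uniformly in the sizes. *)
Lemma ACV2_lower (s0 v : R) : 0 < s0 -> 0 <= v -> v < acv_limit L s0 ->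
  \forall t \near F, forall n1 n2 : R, 1 < n1 -> 1 < n2 ->
    s0 * x t ^+ 2 <= 2 / n1 + 2 / n2 -> (v%:E < ACV2 n1 n2 (1 - x t) (nu t))%E.
Proof.
move=> s00 v0 vS.
have [K vK] : exists K, v < series (fun k => acv_limit_term L s0 k.+1) K.
  have c := is_cvg_acv_limit L_gt0 (ltW s00).
  have [K _ /(_ K (leqnn K))/= vK] := cvgr_gt _ c _ vS.
  by exists K.
set SK := series _ K in vK.
have SK0 : 0 < SK by exact: le_lt_trans vK.
(* Chosen so that (1 - eta) SK is the midpoint of v and SK: half of the gap pays for replacing the
   coefficients by their limits. *)
pose eta := (SK - v) / (2 * SK).
have eta0 : 0 < eta by rewrite divr_gt0 ?mulr_gt0// subr_gt0.
have etaSK : eta * SK = (SK - v) / 2 by rewrite /eta; field; rewrite gt_eqF.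
have eta1 : eta <= 1 by rewrite /eta ler_pdivrMr ?mulr_gt0//; lra.
have g k l : (l <= k)%N -> \forall t \near F,
    (1 - eta) * glimit L k ^+ 2 <= (x t ^+ k * gtilde k l (1 - x t) (nu t)) ^+ 2.
  move=> lk.
  have c : (x t ^+ k * gtilde k l (1 - x t) (nu t)) ^+ 2 @[t --> F] --> glimit L k ^+ 2.
    by apply: cvg_exprn; exact: cvg_gtilde bounds _ _ lk hyp_limit_neq0.
  have g2 : 0 < glimit L k ^+ 2 by rewrite exprn_gt0// glimit_gt0.
  by apply: (cvgr_ge _ c); rewrite gtr_pMl//; lra.
have gK : \forall t \near F, forall (k l : 'I_K.+1), (l <= k)%N ->
    (1 - eta) * glimit L k ^+ 2 <= (x t ^+ k * gtilde k l (1 - x t) (nu t)) ^+ 2.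
  apply: filter_forall => k; apply: filter_forall => l.
  by have [/g|_] := leqP l k; [apply: filterS|apply: nearW].
have lowc : \sum_(k < K) ((1 - eta) * glimit L k.+1 ^+ 2 *
     (s0^-1 + K%:R * x t ^+ 2)^-1 ^+ k.+1 / k.+1`!%:R) @[t --> F] --> (1 - eta) * SK.
  rewrite /SK seriesEord mulr_sumr; apply: (@cvg_sumn _ _ _ FF K (fun k t =>
     (1 - eta) * glimit L k.+1 ^+ 2 * (s0^-1 + K%:R * x t ^+ 2)^-1 ^+ k.+1 / k.+1`!%:R)
     (fun k => (1 - eta) * acv_limit_term L s0 k.+1)) => k kK.
  rewrite /acv_limit_term !mulrA; apply: cvgM; last exact: cvg_cst.
  apply: cvgM; first exact: cvg_cst.
  by apply: cvg_exprn; exact: cvg_inv_add.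
have vlow : v < (1 - eta) * SK by rewrite mulrBl etaSK; lra.
near=> t.
have [nu0 xt0 x4 nM] : [/\ 0 < nu t, 0 < x t, x t <= 4^-1 & (nu t + 1) * x t <= M] by near: t.
move=> n1 n2 h1 h2 sn; apply: (ACV2_gt_partial h1 h2 (K := K)).
apply: (@lt_le_trans _ _ (\sum_(k < K) ((1 - eta) * glimit L k.+1 ^+ 2 *
     (s0^-1 + K%:R * x t ^+ 2)^-1 ^+ k.+1 / k.+1`!%:R))).
  near: t; exact: (cvgr_gt _ lowc).
apply: ler_sum => [[k kK] _] /=.
have gKt : forall (k l : 'I_K.+1), (l <= k)%N ->
    (1 - eta) * glimit L k ^+ 2 <= (x t ^+ k * gtilde k l (1 - x t) (nu t)) ^+ 2 by near: t.
apply: acv_term_lower => //.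
  by rewrite mulr_ge0 ?sqr_ge0// subr_ge0.
move=> l lk; have lK : (l < K.+1)%N by rewrite ltnS (leq_trans lk).
exact: (gKt (Ordinal (kK : (k.+1 < K.+1)%N)) (Ordinal lK) lk).
Unshelve. all: by end_near. Qed.

(** The hypotheses of [poch_ratio_bound] for the pair nu + 1 and the shape of n. *)
Definition size_regime (q n : R) t := [/\ 1 < n, (nu t + 1) ^+ 2 <= q * Defs.shape n
  & 4 * (nu t + 1) <= Defs.shape n].

Lemma near_size_regime (c : R) : 0 < c -> \forall t \near F,
  forall n : R, c * x t ^- 2 <= n -> size_regime (4 * M ^+ 2 / c) n t.
Proof.
move=> c0; near=> t.
have [nu0 xt0 x4 nM] : [/\ 0 < nu t, 0 < x t, x t <= 4^-1 & (nu t + 1) * x t <= M] by near: t.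
have M0 := M_gt0.
(* This bound yields 4 (nu + 1) x^2 <= 4 M x <= c / 4. The next one, with x <= 1/4, gives n >= 2, so
   that the shape is at least n / 4; this accounts for the 4 in the constant 4 M^2 / c. *)
have x1 : x t <= c / (16 * M).
  by near: t; apply: cvgr_le x0 _ _; rewrite divr_gt0// mulr_gt0.
have x2 : x t <= c / 2 by near: t; apply: cvgr_le x0 _ _; rewrite divr_gt0.
move=> n cn; have X2 : 0 < x t ^+ 2 by exact: exprn_gt0.
have {}cn : c <= n * x t ^+ 2 by rewrite -ler_pdivrMr.
have x16 : 16 * M * x t <= c by rewrite mulrC -ler_pdivlMr ?mulr_gt0.
have n2 : 2 <= n.
  rewrite -(ler_pM2r X2); apply: le_trans cn; rewrite expr2; nra.
have sn : n / 4 <= Defs.shape n by rewrite /Defs.shape; lra.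
split; first lra.
- apply: (@le_trans _ _ (4 * M ^+ 2 / c * (n / 4))); last first.
    by rewrite ler_wpM2l// divr_ge0 ?(ltW c0)// mulr_ge0 ?sqr_ge0.
  rewrite -(ler_pM2r X2) -exprMn.
  apply: (@le_trans _ _ (M ^+ 2)).
    by rewrite lerXn2r ?nnegrE ?(ltW M0)// mulr_ge0//; lra.
  have -> : 4 * M ^+ 2 / c * (n / 4) * x t ^+ 2 = M ^+ 2 / c * (n * x t ^+ 2).
    by field; rewrite gt_eqF.
  by rewrite mulrAC ler_pdivlMr// ler_wpM2l ?sqr_ge0.
- apply: le_trans sn; rewrite -(ler_pM2r X2).
  have -> : 4 * (nu t + 1) * x t ^+ 2 = 4 * ((nu t + 1) * x t) * x t by ring.
  have : 4 * ((nu t + 1) * x t) * x t <= 4 * M * x t by rewrite ler_pM2r// ler_pM2l.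
  lra.
Unshelve. all: by end_near. Qed.

Lemma near_acv_majorant (c : R) : 0 < c -> exists U : R, \forall t \near F,
  forall n1 n2 : R, c * x t ^- 2 <= n1 -> c * x t ^- 2 <= n2 ->
    [/\ 1 < n1, 1 < n2 & forall k, acv_term n1 n2 (1 - x t) (nu t) k.+1 <= acv_majorant M U k].
Proof.
move=> c0; have q0 : 0 < 4 * M ^+ 2 / c.
  by rewrite divr_gt0// mulr_gt0// exprn_gt0// M_gt0.
have [U HU] := poch_ratio_bound q0; exists U.
near=> t => n1 n2 cn1 cn2.
have [nu0 xt0 x4 nM] : [/\ 0 < nu t, 0 < x t, x t <= 4^-1 & (nu t + 1) * x t <= M] by near: t.
have reg : forall n : R, c * x t ^- 2 <= n -> size_regime (4 * M ^+ 2 / c) n t.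
  by near: t; exact: near_size_regime.
have [h1 q1 r1] := reg _ cn1; have [h2 q2 r2] := reg _ cn2.
split=> // k; apply: le_trans (acv_term_le _ HU nu0 xt0 x4 nM h1 h2 q1 r1 q2 r2) _.
rewrite /acv_majorant ler_wpM2l ?sqr_ge0// lef_pV2 ?posrE ?exprn_gt0//.
by rewrite lerXn2r ?nnegrE// ler_nat.
Unshelve. all: by end_near. Qed.

(** For n1 = n2 = c x^-2 the scaled sum (2 / n1 + 2 / n2) / x^2 equals 4 / c. Each scaled shape
    tends to c / 2, so the two reciprocals add up to the same value. *)
Lemma cvg_ACV2_diagonal (c : R) : 0 < c ->
  (\forall t \near F, ACV2 (c * x t ^- 2) (c * x t ^- 2) (1 - x t) (nu t) =
     (acv_sum (c * x t ^- 2) (c * x t ^- 2) (1 - x t) (nu t))%:E) /\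
  acv_sum (c * x t ^- 2) (c * x t ^- 2) (1 - x t) (nu t) @[t --> F] --> acv_limit L (4 / c).
Proof.
move=> c0; have [U HU] := near_acv_majorant c0.
have {}HU : \forall t \near F, 1 < c * x t ^- 2 /\
    forall k, `|acv_term (c * x t ^- 2) (c * x t ^- 2) (1 - x t) (nu t) k.+1|
      <= acv_majorant M U k.
  apply: filterS HU => t /(_ _ _ (lexx _) (lexx _))[h _ H]; split=> // k.
  by rewrite ger0_norm// acv_term_ge0.
split.
  apply: filterS HU => t [h H]; apply: ACV2_fin => //.
  exact: (@is_cvg_series_dominated _ _ _ (@is_cvg_acv_majorant R M U) H).
apply: (@tannery _ _ _ FF
   (fun k t => acv_term (c * x t ^- 2) (c * x t ^- 2) (1 - x t) (nu t) k.+1)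
   (fun k => acv_limit_term L (4 / c) k.+1) _ (@is_cvg_acv_majorant R M U)); last first.
  by apply: filterS HU => t [].
move=> k; move: k.+1 => {}k.
pose S t := Defs.shape (c * x t ^- 2).
have xneq : \forall t \near F, x t != 0.
  by apply: filterS bounds => t [_ xt0 _ _]; rewrite gt_eqF.
have xx0 : x t ^+ 2 @[t --> F] --> 0.
  by rewrite -[X in _ --> X](expr0n R 2); exact: cvg_exprn.
have xS : x t ^+ 2 * S t @[t --> F] --> c / 2.
  have E : \forall t \near F, (c - x t ^+ 2) / 2 = x t ^+ 2 * S t.
    apply: filterS xneq => t xt0; rewrite /S /Defs.shape.
    by field.
  apply: cvg_trans (near_eq_cvg E) _; apply: cvgM; last exact: cvg_cst.
  by rewrite -[X in _ --> X]subr0; apply: cvgB => //; exact: cvg_cst.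
have E : \forall t \near F,
   \sum_(l < k.+1) (x t ^+ k * gtilde k l (1 - x t) (nu t)) ^+ 2 *
     ((x t ^+ 2 ^+ l * poch (S t) l)^-1 * (x t ^+ 2 ^+ (k - l) * poch (S t) (k - l))^-1 /
      (l`!%:R * (k - l)`!%:R)) =
   acv_term (c * x t ^- 2) (c * x t ^- 2) (1 - x t) (nu t) k.
  apply: filterS2 xneq HU => t xt0 [h _]; apply: eq_bigr => [[l lk] _] /=.
  rewrite ltnS in lk.
  have -> : x t ^+ k = x t ^+ l * x t ^+ (k - l) by rewrite -exprD subnKC.
  have P1 := poch_gt0 l (shape_gt0 h); have P2 := poch_gt0 (k - l) (shape_gt0 h).
  rewrite -/(S t) in P1 P2 *.
  have f i : 0 < i`!%:R :> R by rewrite ltr0n fact_gt0.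
  move: (gtilde _ _ _ _) => G; rewrite -![x t ^+ 2 ^+ _]exprM ![(2 * _)%N]mulnC !exprM.
  by field; rewrite ?expf_neq0// !gt_eqF.
apply: cvg_trans (near_eq_cvg E) _.
have -> : acv_limit_term L (4 / c) k = \sum_(l < k.+1) glimit L k ^+ 2 *
   (((c / 2) ^+ l)^-1 * ((c / 2) ^+ (k - l))^-1 / (l`!%:R * (k - l)`!%:R)).
  rewrite -mulr_sumr /acv_limit_term -mulrA; congr (_ * _).
  under eq_bigr do rewrite -!exprVn; rewrite sum_binomial_fact; congr (_ ^+ _ / _).
  by field; rewrite gt_eqF.
have c2 : c / 2 != 0 by rewrite gt_eqF// divr_gt0.
apply: (@cvg_sumn _ _ _ FF k.+1 (fun l t => (x t ^+ k * gtilde k l (1 - x t) (nu t)) ^+ 2 *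
     ((x t ^+ 2 ^+ l * poch (S t) l)^-1 * (x t ^+ 2 ^+ (k - l) * poch (S t) (k - l))^-1 /
      (l`!%:R * (k - l)`!%:R)))
   (fun l => glimit L k ^+ 2 *
   (((c / 2) ^+ l)^-1 * ((c / 2) ^+ (k - l))^-1 / (l`!%:R * (k - l)`!%:R)))) => l lk.
rewrite ltnS in lk; apply: cvgM.
  by apply: cvg_exprn; exact: cvg_gtilde bounds _ _ lk hyp_limit_neq0.
apply: cvgM; last exact: cvg_cst.
by apply: cvgM; apply: cvgV; rewrite ?expf_neq0//; exact: cvg_poch_scaled.
Qed.

End acv_asymptotics.

(** * Existence of optimal sizes *)

Section existence.
Context {R : realType}.
Variables (z nu a : R) (Maj : R ^nat).
Hypotheses (a1 : 1 < a) (cMaj : cvgn (series Maj)).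
Hypothesis Maj_le : forall n1 n2, a <= n1 -> a <= n2 ->
  forall k, acv_term n1 n2 z nu k.+1 <= Maj k.

Let term_norm n1 n2 k : a <= n1 -> a <= n2 -> `|acv_term n1 n2 z nu k.+1| <= Maj k.
Proof.
by move=> h1 h2; rewrite ger0_norm ?Maj_le// acv_term_ge0// (lt_le_trans a1).
Qed.

Let ACV2_acv_sum n1 n2 : a <= n1 -> a <= n2 ->
  ACV2 n1 n2 z nu = (acv_sum n1 n2 z nu)%:E.
Proof.
move=> h1 h2; apply: ACV2_fin; rewrite ?(lt_le_trans a1)//.
exact: (@is_cvg_series_dominated _ _ _ cMaj (fun k => term_norm k h1 h2)).
Qed.

(** [Maj] dominates only where both sizes are at least [a]. Cutting the sizes off there gives a
    finite function that is continuous on the whole plane and agrees with [ACV2] on that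
    quadrant. *)
Let acv_trunc (p : R * R) := acv_sum (Num.max p.1 a) (Num.max p.2 a) z nu.

Let continuous_acv_trunc : continuous acv_trunc.
Proof.
move=> p.
have cmax (g : R * R -> R) : {for p, continuous g} ->
    Num.max (g q) a @[q --> p] --> Num.max (g p) a.
  by move=> cg; apply: (@continuous_max _ _ g (fun=> a)) => //; exact: cst_continuous.
have c1 : Num.max q.1 a @[q --> p] --> Num.max p.1 a by apply: cmax; exact: cvg_fst.
have c2 : Num.max q.2 a @[q --> p] --> Num.max p.2 a by apply: cmax; exact: cvg_snd.
have amax (u : R) : a <= Num.max u a by rewrite le_max lexx orbT.
apply: (@tannery _ _ _ _ (fun k q => acv_term (Num.max q.1 a) (Num.max q.2 a) z nu k.+1)
  (fun k => acv_term (Num.max p.1 a) (Num.max p.2 a) z nu k.+1) _ cMaj); last first.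
  by apply: nearW => q k; exact: term_norm.
move=> k.
apply: (@cvg_sumn _ _ _ _ k.+2 (fun l (q : R * R) => gtilde k.+1 l z nu ^+ 2 /
     (poch (Defs.shape (Num.max q.1 a)) l * poch (Defs.shape (Num.max q.2 a)) (k.+1 - l) *
      l`!%:R * (k.+1 - l)`!%:R))
   (fun l => gtilde k.+1 l z nu ^+ 2 /
     (poch (Defs.shape (Num.max p.1 a)) l * poch (Defs.shape (Num.max p.2 a)) (k.+1 - l) *
      l`!%:R * (k.+1 - l)`!%:R))) => l _.
have cpoch (g : R * R -> R) j : g q @[q --> p] --> g p ->
    poch (Defs.shape (g q)) j @[q --> p] --> poch (Defs.shape (g p)) j.
  move=> cg; apply: (@cvg_prodn _ _ _ _ j (fun i q => Defs.shape (g q) + i%:R)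
     (fun i => Defs.shape (g p) + i%:R)) => i.
  apply: cvgD; last exact: cvg_cst.
  apply: cvgM; last exact: cvg_cst.
  by apply: cvgB => //; exact: cvg_cst.
apply: cvgM; first exact: cvg_cst.
apply: cvgV.
  by rewrite gt_eqF// acv_denom_gt0// (lt_le_trans a1).
apply: cvgM; last exact: cvg_cst.
apply: cvgM; last exact: cvg_cst.
apply: cvgM; exact: (cpoch (fun q => Num.max _ a)).
Qed.

(* Minimising the total size over the sublevel set [ACV2 <= v], rather than
   [ACV2] over a segment: by continuity the minimiser has [ACV2 = v], and
   nothing on its segment lies strictly below [v]. *)
Lemma ACV2_minimizer (v m : R) :
  (forall n1 n2, 1 < n1 -> 1 < n2 -> (ACV2 n1 n2 z nu <= v%:E)%E -> a < n1 /\ a < n2) ->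
  1 < m -> (ACV2 m m z nu <= v%:E)%E ->
  exists n1 n2, [/\ 1 < n1, 1 < n2, ACV2 n1 n2 z nu = v%:E &
    forall m1 m2, 1 < m1 -> 1 < m2 -> m1 + m2 = n1 + n2 -> (v%:E <= ACV2 m1 m2 z nu)%E].
Proof.
move=> Ha m1 Dm; have [am _] := Ha _ _ m1 m1 Dm.
(* The pair (m, m) is admissible, so only totals up to 2 m matter; with both coordinates positive,
   each is then at most 2 m. *)
pose K := (`[a, 2 * m] `*` `[a, 2 * m])%classic `&` (acv_trunc @^-1` [set y | y <= v]).
have truncE n1 n2 : a <= n1 -> a <= n2 -> ACV2 n1 n2 z nu = (acv_trunc (n1, n2))%:E.
  by move=> h1 h2; rewrite ACV2_acv_sum// /acv_trunc /= !max_l.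
have inK n1 n2 : K (n1, n2) <->
   [/\ a <= n1 <= 2 * m, a <= n2 <= 2 * m & (ACV2 n1 n2 z nu <= v%:E)%E].
  rewrite /K /= !in_itv /=; split => [[[h1 h2] h]|[h1 h2 h]].
    split=> //; rewrite truncE ?lee_fin//; [by case/andP: h1|by case/andP: h2].
  split=> //; move: h; rewrite truncE ?lee_fin//; [by case/andP: h1|by case/andP: h2].
have Kmm : K (m, m) by apply/inK; split=> //; lra.
have cK : compact K.
  apply: compact_closedI; first by apply: compact_setX; exact: segment_compact.
  by apply: preimage_closed => [p _|]; [exact: continuous_acv_trunc|exact: closed_le].
have [|[n1 n2] /set_mem/inK[b1 b2 Dn] nmin] :=
    @compact_EVT_min _ R (fun p : R * R => p.1 + p.2) K (ex_intro _ _ Kmm) cK.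
  apply: continuous_subspaceT => p; apply: cvgD; [exact: cvg_fst|exact: cvg_snd].
have nm : n1 + n2 <= m + m by apply: (nmin (m, m)); exact/mem_set.
have [an1 _] := andP b1; have [an2 _] := andP b2.
(* A pair strictly below v could give up a small e of its first size and stay in the sublevel set,
   contradicting the minimal total. The strict inequality a < m1' leaves room for this e. *)
have segment m1' m2' : 1 < m1' -> 1 < m2' -> m1' + m2' = n1 + n2 ->
    (v%:E <= ACV2 m1' m2' z nu)%E.
  move=> h1 h2 hs; rewrite leNgt; apply/negP => Dlt.
  have [am1 am2] := Ha _ _ h1 h2 (ltW Dlt).
  have fm : acv_trunc (m1', m2') < v by rewrite -lte_fin -truncE// ltW.
  have cf : acv_trunc (m1' - e, m2') @[e --> 0^'+] --> acv_trunc (m1', m2').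
    apply: (@cvg_comp _ _ _ (fun e => (m1' - e, m2')) acv_trunc _ (nbhs (m1', m2'))); last first.
      exact: continuous_acv_trunc.
    have c1 : m1' - e @[e --> 0^'+] --> m1'.
      rewrite -[X in _ --> X]subr0; apply: cvgB; first exact: cvg_cst.
      by apply: cvg_at_right_filter; exact: cvg_id.
    have c2 : (fun=> m2') e @[e --> (0 : R)^'+] --> m2' by exact: cvg_cst.
    exact: (cvg_pair c1 c2).
  have near_e : \forall e \near 0^'+, [/\ 0 < e, e <= m1' - a & acv_trunc (m1' - e, m2') < v].
    near=> e; split.
    - by near: e; exact: nbhs_right_gt.
    - by near: e; apply: nbhs_right_le; rewrite subr_gt0.
    - by near: e; exact: (cvgr_lt _ cf).
  have [e [e0 em ev]] := filter_ex near_e.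
  have ae : a <= m1' - e by lra.
  have : n1 + n2 <= (m1' - e) + m2'.
    apply: (nmin (m1' - e, m2')); apply/mem_set/inK; split.
    - by apply/andP; split; lra.
    - by apply/andP; split; lra.
    - by rewrite truncE ?lee_fin// ltW.
  by lra.
have n1gt : 1 < n1 by exact: lt_le_trans an1.
have n2gt : 1 < n2 by exact: lt_le_trans an2.
exists n1, n2; split=> //.
(* The minimiser lies on its own segment, so [segment] also gives v <= [ACV2] there. *)
by apply/eqP; rewrite eq_le Dn segment.
Unshelve. all: by end_near. Qed.

End existence.

(** * The exponential integral *)

Section derivatives.
Context {R : realType}.
Implicit Types (f g : R -> R) (x a b c : R).

Lemma is_derive_const a x : is_derive x (1 : R) (fun=> a) 0.
Proof. exact: is_derive_cst. Qed.

Lemma is_derive_add f g x a b : is_derive x (1 : R) f a -> is_derive x (1 : R) g b ->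
  is_derive x (1 : R) (fun y => f y + g y) (a + b).
Proof. by move=> hf hg; exact: (is_deriveD hf hg). Qed.

Lemma is_derive_mul f g x a b : is_derive x (1 : R) f a -> is_derive x (1 : R) g b ->
  is_derive x (1 : R) (fun y => f y * g y) (a * g x + f x * b).
Proof.
move=> hf hg; have -> : a * g x + f x * b = f x *: b + g x *: a.
  by rewrite /GRing.scale /=; ring.
exact: (is_deriveM hf hg).
Qed.

Lemma is_derive_mulc f x a c : is_derive x (1 : R) f a ->
  is_derive x (1 : R) (fun y => f y * c) (a * c).
Proof.
move=> hf; have := is_derive_mul hf (is_derive_cst c x 1).
by rewrite mulr0 addr0.
Qed.

Lemma is_derive_expr n x : is_derive x (1 : R) (fun y => y ^+ n) (n%:R * x ^+ n.-1).
Proof.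
elim: n => [|n ih].
  have -> : (fun y : R => y ^+ 0) = cst 1 by apply/funext => y; rewrite expr0.
  by rewrite mul0r; exact: is_derive_cst.
have -> : (fun y : R => y ^+ n.+1) = (fun y => y * y ^+ n).
  by apply/funext => y; rewrite exprS.
have -> : n.+1%:R * x ^+ n = 1 * x ^+ n + x * (n%:R * x ^+ n.-1).
  case: n {ih} => [|n]; first by rewrite expr0; ring.
  by rewrite [n.+1.-1]/= exprS -natr1; ring.
exact: is_derive_mul (is_derive_id x 1) ih.
Qed.

Lemma is_derive_compose f g x a b : is_derive (g x) (1 : R) f a ->
  is_derive x (1 : R) g b -> is_derive x (1 : R) (fun y => f (g y)) (a * b).
Proof. by move=> hf hg; exact: (is_derive1_comp hf hg). Qed.

End derivatives.

Section exponential_integral.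
Context {R : realType}.
Implicit Types (b c t y z r : R) (k m n : nat).

(** (e^y - 1) / y with the value 1 at 0. [Ein] is its antiderivative vanishing at 0, that is, [Ei]
    without its logarithm and Euler's constant. *)
Definition ein y : R := limn (series (fun m => y ^+ m / m.+1`!%:R)).
Definition Ein y : R := limn (series (fun m => y ^+ m.+1 / (m.+1%:R * m.+1`!%:R))).

Let ein_term_le b y m : `|y| <= b -> `|y ^+ m / m.+1`!%:R| <= exp_coeff b m.
Proof.
move=> yb; have b0 : 0 <= b by exact: le_trans yb.
rewrite /exp_coeff /= normrM normrX [`|_^-1|]ger0_norm ?invr_ge0//.
apply: ler_pM; rewrite ?exprn_ge0 ?invr_ge0//; first by rewrite lerXn2r ?nnegrE.
by rewrite lef_pV2 ?posrE// ler_nat factS leq_pmull.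
Qed.

Let is_cvg_ein y : cvgn (series (fun m => y ^+ m / m.+1`!%:R)).
Proof.
apply: is_cvg_series_dominated (is_cvg_series_exp_coeff `|y|) _ => m.
exact: ein_term_le.
Qed.

Lemma einE y : y * ein y = expR y - 1.
Proof.
have c := cvg_series_shift (is_cvg_series_exp_coeff y).
have -> : expR y - 1 = limn (series (exp_coeff y)) - exp_coeff y 0%N.
  by rewrite /exp_coeff /= expr0 fact0 divr1.
rewrite -(cvg_lim _ c)// /ein -[LHS]/(y *: _) -lim_seriesZ; last exact: is_cvg_ein.
congr (limn (series _)); apply/funext => m.
by rewrite /exp_coeff /= exprS -mulrA.
Qed.

Lemma ein0 : ein 0 = 1.
Proof.
rewrite /ein; apply/cvg_lim => //.
rewrite -(cvg_shiftS (series _)).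
apply: cvg_trans (@cvg_cst _ (1 : R) nat \oo _); apply: near_eq_cvg; apply: nearW => n.
rewrite /series /= big_nat_recl// expr0 divr1 big1 ?addr0// => i _.
by rewrite expr0n mul0r.
Qed.

Lemma continuous_ein : continuous ein.
Proof.
move=> y; apply: (@tannery R R (nbhs y) _ (fun m y => y ^+ m / m.+1`!%:R)
  (fun m => y ^+ m / m.+1`!%:R) _ (is_cvg_series_exp_coeff (`|y| + 1))).
  by move=> m; apply: cvgM; [apply: cvg_exprn; exact: cvg_id|exact: cvg_cst].
near=> u => m; apply: ein_term_le.
have yu : `|y - u| < 1 by near: u; apply: cvgr_dist_lt => //; exact: cvg_id.
have := ler_normB y (y - u); have -> : y - (y - u) = u by ring.
lra.
Unshelve. all: by end_near. Qed.

Lemma is_derive_Ein y : is_derive y (1 : R) Ein (ein y).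
Proof.
apply: (@is_derive_series R (fun m y => y ^+ m.+1 / (m.+1%:R * m.+1`!%:R))
  (fun m y => y ^+ m / m.+1`!%:R) (exp_coeff (`|y| + 1)) (`|y| + 1)).
- by rewrite ltrDl.
- exact: is_cvg_series_exp_coeff.
- move=> m u.
  have -> : u ^+ m / m.+1`!%:R = (m.+1%:R * u ^+ m) * (m.+1%:R * m.+1`!%:R)^-1.
    by field; rewrite !gt_eqF.
  by apply: is_derive_mulc; exact: is_derive_expr.
- by move=> m u /ltW ub; exact: ein_term_le.
- by move=> m; rewrite expr0n mul0r.
Qed.

Lemma Ein0 : Ein 0 = 0.
Proof.
rewrite /Ein; apply/cvg_lim => //.
apply: cvg_trans (@cvg_cst _ (0 : R) nat \oo _); apply: near_eq_cvg; apply: nearW => n.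
by rewrite /series /= big1// => i _; rewrite expr0n mul0r.
Qed.

Lemma Rintegral_ein a b : a < b ->
  \int[lebesgue_measure]_(t in `[a, b]) ein t = Ein b - Ein a.
Proof.
move=> ab; rewrite /Rintegral (@continuous_FTC2 _ ein Ein)//.
- by apply: continuous_subspaceT; exact: continuous_ein.
- split.
  + by move=> u _; have [] := is_derive_Ein u.
  + by apply: cvg_at_right_filter; exact: is_derive_continuous (is_derive_Ein a).
  + by apply: cvg_at_left_filter; exact: is_derive_continuous (is_derive_Ein b).
- by move=> u _; have [_ E] := is_derive_Ein u; rewrite derive1E E.
Qed.

Let integrable_ein a b : lebesgue_measure.-integrable `[a, b] (EFin \o ein).
Proof.
apply: continuous_compact_integrable; first exact: segment_compact.
by apply: continuous_subspaceT; exact: continuous_ein.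
Qed.

Lemma ein_neq0 y : y != 0 -> (expR y - 1) / y = ein y.
Proof. by move=> y0; rewrite -einE mulrC mulKf. Qed.

(** At 0 the integrand of [Ein_int] takes the value 0 by the convention on division, not 1. The
    endpoint 0 is therefore removed as a null set, the integrands are exchanged on the half-open
    interval, and the endpoint is restored. *)
Lemma Ein_intE z : Ein_int z = Ein z.
Proof.
have eq0 (D : set R) : (forall y, D y -> y != 0) ->
    {in D, (fun y => (expR y - 1) / y) =1 ein}.
  by move=> D0 y /set_mem /D0; exact: ein_neq0.
have meas (i : interval R) : lebesgue_measure.-integrable [set` i] (EFin \o ein) ->
    (forall y, y \in i -> y != 0) ->
    lebesgue_measure.-integrable [set` i] (EFin \o (fun y => (expR y - 1) / y)).
  move=> H i0; apply: eq_integrable H => //.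
  by move=> y /set_mem yi /=; rewrite ein_neq0//; exact: i0.
rewrite /Ein_int; case: ifPn => [z0|]; last rewrite -ltNge => z0.
  have [->|zn0] := eqVneq z 0; first by rewrite set_itv1 Rintegral_set1 Ein0.
  have zp : 0 < z by rewrite lt_def zn0.
  rewrite -Rintegral_itv_obnd_cbnd.
    transitivity (\int[lebesgue_measure]_(t in `]0, z]) ein t).
      apply: eq_Rintegral; apply: eq0 => y /=.
      by rewrite in_itv /= => /andP[y0 _]; rewrite gt_eqF.
    rewrite Rintegral_itv_obnd_cbnd ?Rintegral_ein// ?Ein0 ?subr0//.
    by apply: integrableS (integrable_ein 0 z) => //; exact: subset_itv_oc_cc.
  apply: meas; first by apply: integrableS (integrable_ein 0 z) => //; exact: subset_itv_oc_cc.
  by move=> y; rewrite in_itv /= => /andP[y0 _]; rewrite gt_eqF.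
rewrite -Rintegral_itv_bndo_bndc.
  transitivity (- \int[lebesgue_measure]_(t in `[z, 0[) ein t).
    congr (- _); apply: eq_Rintegral; apply: eq0 => y /=.
    by rewrite in_itv /= => /andP[_ y0]; rewrite lt_eqF.
  rewrite Rintegral_itv_bndo_bndc ?Rintegral_ein// ?Ein0 ?sub0r ?opprK//.
  by apply: integrableS (integrable_ein z 0) => //; exact: subset_itv_co_cc.
apply: meas; first by apply: integrableS (integrable_ein z 0) => //; exact: subset_itv_co_cc.
by move=> y; rewrite in_itv /= => /andP[_ y0]; rewrite lt_eqF.
Qed.

End exponential_integral.

(** * Closed form of the limiting series *)

Section poisson_tails.
Context {R : realType}.
Implicit Types (b c t y r : R) (k n : nat).

(* [poisson_tail n t] is the probability that a Poisson variable of mean [t] is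
   at least [n]. *)
Definition poisson_tail n t : R := 1 - expR (- t) * series (exp_coeff t) n.

Lemma poisson_tail0 t : poisson_tail 0 t = 1.
Proof. by rewrite /poisson_tail /series /= big_geq// mulr0 subr0. Qed.

Lemma poisson_tailS n t :
  poisson_tail n.+1 t = poisson_tail n t - expR (- t) * (t ^+ n / n`!%:R).
Proof. by rewrite /poisson_tail seriesSr /exp_coeff /=; ring. Qed.

Lemma poisson_tailS0 n : poisson_tail n.+1 0 = 0.
Proof.
elim: n => [|n ih]; rewrite poisson_tailS.
  by rewrite poisson_tail0 oppr0 expR0 expr0 fact0; lra.
by rewrite ih expr0n /=; lra.
Qed.

(** The derivative of the Poisson mass at k is the mass at k - 1 minus the mass at k, so the sum of
    derivatives telescopes. *)
Lemma is_derive_poisson_tail n t :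
  is_derive t (1 : R) (poisson_tail n.+1) (expR (- t) * (t ^+ n / n`!%:R)).
Proof.
have dexp : is_derive t (1 : R) (fun y => expR (- y)) (- expR (- t)).
  have := is_derive_compose (is_derive_expR (- t)) (is_deriveNid t 1).
  by rewrite mulrN1.
have dterm k : is_derive t (1 : R) (fun y => expR (- y) * (y ^+ k / k`!%:R))
    (- expR (- t) * (t ^+ k / k`!%:R) + expR (- t) * (k%:R * t ^+ k.-1 / k`!%:R)).
  exact: is_derive_mul dexp (is_derive_mulc _ (is_derive_expr k t)).
have f k : k`!%:R != 0 :> R by rewrite gt_eqF// ltr0n fact_gt0.
elim: n => [|n ih].
  have -> : poisson_tail 1 = (fun y => 1 + expR (- y) * (y ^+ 0 / 0`!%:R) * (- 1)).
    by apply/funext => y; rewrite poisson_tailS poisson_tail0; ring.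
  have -> : expR (- t) * (t ^+ 0 / 0`!%:R) = 0 +
    (- expR (- t) * (t ^+ 0 / 0`!%:R) + expR (- t) * (0%:R * t ^+ 0.-1 / 0`!%:R)) * (- 1).
    by rewrite mul0r; ring.
  exact: is_derive_add (is_derive_const 1 t) (is_derive_mulc (- 1) (dterm 0%N)).
have -> : poisson_tail n.+2 = (fun y => poisson_tail n.+1 y +
    expR (- y) * (y ^+ n.+1 / n.+1`!%:R) * (- 1)).
  by apply/funext => y; rewrite [LHS]poisson_tailS; ring.
have -> : expR (- t) * (t ^+ n.+1 / n.+1`!%:R) = expR (- t) * (t ^+ n / n`!%:R) +
   (- expR (- t) * (t ^+ n.+1 / n.+1`!%:R) +
    expR (- t) * (n.+1%:R * t ^+ n.+1.-1 / n.+1`!%:R)) * (- 1).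
  rewrite /= factS natrM; field; rewrite f /=.
  by rewrite gt_eqF.
exact: is_derive_add ih (is_derive_mulc _ (dterm n.+1)).
Qed.

(** The tail vanishes at 0, so the mean value inequality applies. Negative y are included, although
    the probabilistic meaning is lost there, because [tail_energy] is later differentiated on the
    whole line. *)
Lemma poisson_tail_le n b y : `|y| < b ->
  `|poisson_tail n.+1 y| <= b * (expR b * (b ^+ n / n`!%:R)).
Proof.
move=> yb; have b0 : 0 < b by exact: le_lt_trans yb.
have bb := ltW b0.
have dle u : `|u| < b -> `|expR (- u) * (u ^+ n / n`!%:R)| <= expR b * (b ^+ n / n`!%:R).
  move=> ub; rewrite normrM ger0_norm ?expR_ge0// normrM normrX.
  rewrite [`|_^-1|]ger0_norm ?invr_ge0//.
  apply: ler_pM; rewrite ?expR_ge0 ?divr_ge0 ?exprn_ge0//.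
    by rewrite ler_expR; move: ub; rewrite ltr_norml => /andP[? ?]; lra.
  by rewrite ler_wpM2r ?invr_ge0// lerXn2r ?nnegrE// ltW.
have b0' : `|0 : R| < b by rewrite normr0.
have := mean_value_le (is_derive_poisson_tail n) dle yb b0'.
rewrite poisson_tailS0 !subr0 => /le_trans; apply.
rewrite mulrC ler_wpM2r ?(ltW yb)//.
by rewrite mulr_ge0 ?expR_ge0// divr_ge0// exprn_ge0.
Qed.

Let cvg_tail_series t r : cvgn (series (fun k => poisson_tail k.+1 t * r ^+ k)).
Proof.
pose b : R := `|t| + 1; have tb : `|t| < b by rewrite ltrDl.
have : cvgn (series ((b * expR b) *: exp_coeff (b * `|r|))).
  by apply: is_cvg_seriesZ; exact: is_cvg_series_exp_coeff.
move=> /(@is_cvg_series_dominated _ (fun k => poisson_tail k.+1 t * r ^+ k)); apply => k.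
rewrite normrM normrX; apply: le_trans (ler_wpM2r _ (poisson_tail_le k tb)) _.
  exact: exprn_ge0.
rewrite le_eqVlt; apply/orP; left; apply/eqP.
by rewrite /exp_coeff -[RHS]/(b * expR b * ((b * `|r|) ^+ k / k`!%:R)) exprMn; ring.
Qed.

Let cvg_tail_term t r : poisson_tail k t * r ^+ k @[k --> \oo] --> (0 : R).
Proof.
rewrite -(cvg_shiftS (fun k => poisson_tail k t * r ^+ k)).
have -> : (fun n => poisson_tail n.+1 t * r ^+ n.+1) =
   (fun n => r * (poisson_tail n.+1 t * r ^+ n)).
  by apply/funext => n; rewrite exprS; ring.
have c0 : poisson_tail n.+1 t * r ^+ n @[n --> \oo] --> (0 : R).
  exact: cvg_series_cvg_0 (@cvg_tail_series t r).
by have := cvgM (@cvg_cst _ r nat \oo _) c0; rewrite mulr0; apply.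
Qed.

(** Summation by parts. The tails decay faster than any geometric sequence, so r may be any real;
    keeping the factor 1 - r on the left avoids a case distinction at r = 1. *)
Lemma poisson_tail_gen t r :
  (1 - r) * limn (series (fun k => poisson_tail k.+1 t * r ^+ k)) = 1 - expR (t * r - t).
Proof.
have S n : (1 - r) * series (fun k => poisson_tail k.+1 t * r ^+ k) n =
    1 - expR (- t) * series (exp_coeff (t * r)) n - poisson_tail n t * r ^+ n.
  elim: n => [|n ih].
    by rewrite /series /= !big_geq// poisson_tail0 expr0; ring.
  rewrite !seriesSr mulrDr ih poisson_tailS /exp_coeff /= exprMn exprS.
  by move: (_`!%:R^-1) => f; ring.
have c : (1 - r) * series (fun k => poisson_tail k.+1 t * r ^+ k) n @[n --> \oo] -->
    (1 - r) * limn (series (fun k => poisson_tail k.+1 t * r ^+ k)).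
  by apply: cvgM; [exact: cvg_cst|exact: cvg_tail_series].
rewrite -(cvg_lim _ c)//; apply/cvg_lim => //.
have -> : 1 - expR (t * r - t) = 1 - expR (- t) * expR (t * r) - 0.
  by rewrite [t * r - t]addrC expRD subr0.
under eq_fun do rewrite S.
apply: cvgB; last exact: cvg_tail_term.
apply: cvgB; first exact: cvg_cst.
by apply: cvgM; [exact: cvg_cst|exact: is_cvg_series_exp_coeff].
Qed.

(* The case [r = 1] of the generating function: the mean of a Poisson variable. *)
Lemma poisson_tail_sum t : limn (series (fun k => poisson_tail k.+1 t)) = t.
Proof.
(* For N Poisson of mean t, this says that the sum of P(N > k) over k <= n is (n + 1) P(N > n) plus
   the mean of N restricted to N <= n. *)
have S n : series (fun k => poisson_tail k.+1 t) n.+1 =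
    n.+1%:R * poisson_tail n.+1 t + t * (expR (- t) * series (exp_coeff t) n).
  elim: n => [|n ih].
    by rewrite /series /= big_nat1 big_geq//; ring.
  have f0 : n`!%:R != 0 :> R by rewrite gt_eqF// ltr0n fact_gt0.
  rewrite seriesSr ih [series (exp_coeff t) n.+1]seriesSr !(poisson_tailS n.+1) /exp_coeff /=.
  rewrite factS natrM exprS -[n.+2%:R]natr1; field; rewrite f0 /=.
  by rewrite gt_eqF.
have c1 : n.+1%:R * poisson_tail n.+1 t @[n --> \oo] --> (0 : R).
  pose b : R := `|t| + 1; have tb : `|t| < b by rewrite ltrDl.
  have b0 : 0 <= b by exact: ltW (le_lt_trans _ tb).
  have c2 : b * expR b * exp_coeff (2 * b) n @[n --> \oo] --> (0 : R).
    by rewrite -(mulr0 (b * expR b)); apply: cvgM; [exact: cvg_cst|exact: cvg_exp_coeff].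
  have le n : `|n.+1%:R * poisson_tail n.+1 t| <= b * expR b * exp_coeff (2 * b) n.
    rewrite normrM normr_nat.
    have -> : b * expR b * exp_coeff (2 * b) n = 2 ^+ n * (b * (expR b * (b ^+ n / n`!%:R))).
      by rewrite /exp_coeff /= exprMn; ring.
    apply: ler_pM => //; last exact: poisson_tail_le.
    by rewrite -natrX ler_nat ltn_expl.
  have c3 : - (b * expR b * exp_coeff (2 * b) n) @[n --> \oo] --> (0 : R).
    by have := cvgN c2; rewrite oppr0; apply.
  apply: squeeze_cvgr c3 c2; apply: nearW => n.
  by have := le n; rewrite ler_norml.
apply/cvg_lim => //; rewrite -(cvg_shiftS (series _)).
under eq_fun do rewrite S.
have c4 : expR (- t) * series (exp_coeff t) n @[n --> \oo] --> expR (- t) * expR t.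
  by apply: cvgM; [exact: cvg_cst|exact: is_cvg_series_exp_coeff].
have c5 : t * (expR (- t) * series (exp_coeff t) n) @[n --> \oo] --> t * (expR (- t) * expR t).
  by apply: cvgM => //; exact: cvg_cst.
have c6 := cvgD c1 c5.
by rewrite -expRD addNr expR0 mulr1 add0r in c6; exact: c6.
Qed.

Variables (c : R) (c_gt0 : 0 < c).

Definition tail_energy t : R :=
  limn (series (fun k => k`!%:R * poisson_tail k.+1 t ^+ 2 / c ^+ k)).

(** The weight k! cancels the factorial in the derivative of the tail, leaving a generating function
    of tails at t / c. *)
Lemma is_derive_tail_energy t : is_derive t (1 : R) tail_energy
  (2 * expR (- t) * limn (series (fun k => poisson_tail k.+1 t * (t / c) ^+ k))).
Proof.
pose b : R := `|t| + 1; have tb : `|t| < b by rewrite ltrDl.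
have b0 : 0 < b by exact: le_lt_trans tb.
pose df k y := (2 * expR (- y)) * (poisson_tail k.+1 y * (y / c) ^+ k).
have -> : 2 * expR (- t) * limn (series (fun k => poisson_tail k.+1 t * (t / c) ^+ k)) =
    limn (series (df ^~ t)).
  by rewrite -[LHS]/(_ *: _) -lim_seriesZ//; exact: cvg_tail_series.
have f k : k`!%:R != 0 :> R by rewrite gt_eqF// ltr0n fact_gt0.
apply: (@is_derive_series R (fun k y => k`!%:R * poisson_tail k.+1 y ^+ 2 / c ^+ k)
  df (fun k => (2 * expR b * b * expR b) *: exp_coeff (b ^+ 2 / c) k) b).
- exact: tb.
- by apply: is_cvg_seriesZ; exact: is_cvg_series_exp_coeff.
- move=> k y.
  have -> : df k y = (expR (- y) * (y ^+ k / k`!%:R) * poisson_tail k.+1 y +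
      poisson_tail k.+1 y * (expR (- y) * (y ^+ k / k`!%:R))) * (k`!%:R / c ^+ k).
    rewrite /df exprMn exprVn; field.
    by rewrite f expf_neq0// gt_eqF.
  have -> : (fun y => k`!%:R * poisson_tail k.+1 y ^+ 2 / c ^+ k) =
     (fun y => poisson_tail k.+1 y * poisson_tail k.+1 y * (k`!%:R / c ^+ k)).
    by apply/funext => u; ring.
  apply: is_derive_mulc.
  exact: is_derive_mul (is_derive_poisson_tail k y) (is_derive_poisson_tail k y).
- move=> k y yb.
  have -> : (2 * expR b * b * expR b) *: exp_coeff (b ^+ 2 / c) k =
     2 * expR b * (b * (expR b * (b ^+ k / k`!%:R)) * (b / c) ^+ k).
    have bk : (b ^+ 2 / c) ^+ k = b ^+ k * (b / c) ^+ k.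
      by rewrite -exprMn; congr (_ ^+ k); ring.
    rewrite -[LHS]/(_ * ((b ^+ 2 / c) ^+ k / k`!%:R)) bk; ring.
  rewrite /df normrM [`|2 * _|]ger0_norm ?mulr_ge0 ?expR_ge0//.
  rewrite normrM normrX normrM [`|c^-1|]gtr0_norm ?invr_gt0//.
  have yb' := yb; move: yb'; rewrite ltr_norml => /andP[yb1 yb2].
  have ci0 : 0 <= c^-1 by rewrite invr_ge0 ltW.
  have yc0 : 0 <= `|y| * c^-1 by exact: mulr_ge0.
  apply: ler_pM.
  - by rewrite mulr_ge0 ?expR_ge0.
  - by rewrite mulr_ge0 ?exprn_ge0.
  - by rewrite ler_pM2l// ler_expR; lra.
  apply: ler_pM => //; first exact: exprn_ge0.
    exact: poisson_tail_le.
  rewrite lerXn2r ?nnegrE//; first by rewrite mulr_ge0// ltW.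
  by rewrite ler_wpM2r// ltW.
- by move=> k; rewrite poisson_tailS0 expr0n /= mulr0 mul0r.
Qed.

Lemma tail_energyE t : tail_energy t =
  c * expR (- c) * (Ein c - 2 * Ein (c - t) + Ein ((c - t) ^+ 2 / c)).
Proof.
pose G t := Ein c - 2 * Ein (c - t) + Ein ((c - t) ^+ 2 / c).
have dct (u : R) : is_derive u (1 : R) (fun y => c - y) (- 1).
  have := is_derive_add (is_derive_const c u) (is_deriveNid u 1).
  by rewrite add0r.
have dG (u : R) : is_derive u (1 : R) G
   (0 + ein (c - u) * (- 1) * (- 2) +
    ein ((c - u) ^+ 2 / c) * (2%:R * (c - u) ^+ 2.-1 * (- 1) / c)).
  have -> : G = (fun y => Ein c + Ein (c - y) * (- 2) + Ein ((c - y) ^+ 2 / c)).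
    by apply/funext => y; rewrite /G; ring.
  have d1 := is_derive_mulc (- 2) (@is_derive_compose R Ein (fun y => c - y) u _ _
    (is_derive_Ein (c - u)) (dct u)).
  have d2 := @is_derive_compose R (fun y => y ^+ 2) (fun y => c - y) u _ _
    (is_derive_expr 2 (c - u)) (dct u).
  have d3 := @is_derive_compose R Ein (fun y => (c - y) ^+ 2 / c) u _ _
    (is_derive_Ein _) (is_derive_mulc c^-1 d2).
  exact: is_derive_add (is_derive_add (is_derive_const (Ein c) u) d1) d3.
have cn0 : c != 0 by rewrite gt_eqF.
have key (u : R) : 2 * expR (- u) * limn (series (fun k => poisson_tail k.+1 u * (u / c) ^+ k)) =
   (0 + ein (c - u) * (- 1) * (- 2) +
    ein ((c - u) ^+ 2 / c) * (2%:R * (c - u) ^+ 2.-1 * (- 1) / c)) * (c * expR (- c)).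
  rewrite /= expr1.
  (* At u = c the generating function is evaluated at 1, where its closed form degenerates; the
     Poisson mean and [ein] 0 = 1 replace it. This point is the removable singularity of the
     bracket. *)
  have [->|uc] := eqVneq u c.
    rewrite subrr expr0n mul0r ein0 divff//.
    under eq_fun do rewrite expr1n mulr1.
    by rewrite poisson_tail_sum; ring.
  have cu : c - u != 0 by rewrite subr_eq0 eq_sym.
  rewrite -(ein_neq0 cu) -(@ein_neq0 _ ((c - u) ^+ 2 / c)); last first.
    by rewrite mulf_neq0 ?invr_eq0// expf_neq0.
  have -> : limn (series (fun k => poisson_tail k.+1 u * (u / c) ^+ k)) =
      (1 - expR (u * (u / c) - u)) / (1 - u / c).
    rewrite -poisson_tail_gen mulrAC divff ?mul1r//.
    by rewrite subr_eq0 eq_sym; apply: contra_neq uc => h; rewrite -[u](divfK cn0) h mul1r.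
  have e1 : expR (c - u) * expR (- c) = expR (- u) by rewrite -expRD; congr expR; ring.
  have e2 : expR ((c - u) ^+ 2 / c) * expR (- c) = expR (- u) * expR (u * (u / c) - u).
    by rewrite -!expRD; congr expR; field.
  have -> : (1 - u / c) = (c - u) / c by field.
  transitivity (2 * c / (c - u) * (expR (- u) - expR (- u) * expR (u * (u / c) - u))).
    by field; rewrite cn0 cu.
  by rewrite -e2 -e1; field; rewrite cn0 cu.
have d0 (u : R) : is_derive u (1 : R)
    (fun y => tail_energy y + G y * (c * expR (- c)) * (- 1)) 0.
  have -> : 0 = 2 * expR (- u) * limn (series (fun k => poisson_tail k.+1 u * (u / c) ^+ k))
     + (0 + ein (c - u) * (- 1) * (- 2) +
    ein ((c - u) ^+ 2 / c) * (2%:R * (c - u) ^+ 2.-1 * (- 1) / c)) * (c * expR (- c)) * (- 1).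
    by rewrite -key; ring.
  exact: is_derive_add (is_derive_tail_energy u)
    (is_derive_mulc (- 1) (is_derive_mulc (c * expR (- c)) (dG u))).
(* Both sides vanish at t = 0: every tail involved does, and the three [Ein] terms cancel as c^2 / c
   = c. *)
have := is_derive_0_is_cst t 0 d0.
have -> : G 0 = 0 by rewrite /G subr0 expr2 mulfK//; ring.
have -> : tail_energy 0 = 0.
  apply/cvg_lim => //.
  apply: cvg_trans (@cvg_cst _ (0 : R) nat \oo _); apply: near_eq_cvg; apply: nearW => n.
  by rewrite /series /= big1// => i _; rewrite poisson_tailS0 expr0n mulr0 mul0r.
rewrite -/(G t) => h; lra.
Qed.

End poisson_tails.

Section limit_closed_form.
Context {R : realType}.
Implicit Types (L c s v C arb : R) (k n m : nat).

Lemma cvg_series_shiftn (u : R ^nat) m : cvgn (series u) ->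
  series (fun k => u (k + m)%N) n @[n --> \oo] --> limn (series u) - series u m.
Proof.
move=> cu; have cum : series u (n + m)%N @[n --> \oo] --> limn (series u).
  by move: cu; rewrite -(cvg_shiftn m (series u)).
have -> : series (fun k => u (k + m)%N) = (fun n => series u (n + m)%N - series u m).
  apply/funext => n; rewrite series_addn addrC addKr.
  by rewrite /series /= -{2}(add0n m) big_addn addnK.
by apply: cvgB => //; exact: cvg_cst.
Qed.

Lemma poisson_tail1_gt0 L : 0 < L -> 0 < poisson_tail 1 L.
Proof.
move=> L0; rewrite poisson_tailS poisson_tail0 expr0 divr1 mulr1 subr_gt0.
by rewrite -expR0 ltr_expR oppr_lt0.
Qed.

(** Multiplied by L^(k+1) / (k + 1)!, the series for 1F1(1; k + 2; L) becomes the exponential series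
    from index k + 1 on. *)
Lemma hyp_limit_poisson L k : 0 < L ->
  hyp_limit L k = k.+1`!%:R / L ^+ k.+1 * (expR L * poisson_tail k.+1 L).
Proof.
move=> L0; have f n : n`!%:R != 0 :> R by rewrite gt_eqF// ltr0n fact_gt0.
have Ln0 : L != 0 by rewrite gt_eqF.
have cexp := is_cvg_series_exp_coeff L.
have c := @cvg_series_shiftn _ k.+1 cexp.
have -> : expR L * poisson_tail k.+1 L = limn (series (exp_coeff L)) - series (exp_coeff L) k.+1.
  by rewrite mulrBr mulr1 mulrA -expRD subrr expR0 mul1r.
rewrite -(cvg_lim _ c)// -[RHS]/(_ *: _) -lim_seriesZ; last exact: cvgP c.
rewrite /hyp_limit; congr (limn (series _)); apply/funext => j.
rewrite -[RHS]/(k.+1`!%:R / L ^+ k.+1 * (L ^+ (j + k.+1) / (j + k.+1)`!%:R)).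
rewrite exprD; elim: j => [|j ih].
  by rewrite big_ord0 expr0 add0n; field; rewrite f expf_neq0.
rewrite big_ord_recr /= ih addSn [(j + k.+1).+1`!]factS natrM [L ^+ j.+1]exprS.
have -> : k.+2%:R + j%:R = (j + k.+1).+1%:R :> R by rewrite -natrD addSn addnC.
by field; rewrite !f !expf_neq0//= gt_eqF.
Qed.

Lemma glimit_poisson L k : 0 < L ->
  glimit L k = k`!%:R * poisson_tail k.+1 L / poisson_tail 1 L.
Proof.
move=> L0; have f n : n`!%:R != 0 :> R by rewrite gt_eqF// ltr0n fact_gt0.
have p1 := poisson_tail1_gt0 L0; have e0 := expR_gt0 L.
rewrite /glimit !hyp_limit_poisson// expr1 (_ : 1`! = 1%N)// exprS.
by field; rewrite !f expf_neq0 !gt_eqF.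
Qed.

(** The -1 removes the term k = 0, which equals 1 because G_0 = 1, whereas the series of ACV^2
    starts at k = 1. *)
Lemma acv_limit_energy L c : 0 < L -> 0 < c ->
  acv_limit L c^-1 = tail_energy c L / poisson_tail 1 L ^+ 2 - 1.
Proof.
move=> L0 c0; have p1 := poisson_tail1_gt0 L0.
have f n : n`!%:R != 0 :> R by rewrite gt_eqF// ltr0n fact_gt0.
have s0 : 0 <= c^-1 by rewrite invr_ge0 ltW.
have cu : cvgn (series (acv_limit_term L c^-1)).
  apply: is_cvg_series_dominated (is_cvg_series_exp_coeff (L ^+ 2 * c^-1)) _ => k.
  exact: acv_limit_term_le.
rewrite /acv_limit (cvg_lim _ (cvg_series_shift cu))//.
congr (_ - _); last first.
  rewrite /acv_limit_term glimit_poisson// expr0 fact0 mul1r divff ?gt_eqF//.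
  by rewrite expr1n divr1 mulr1.
have -> : tail_energy c L = poisson_tail 1 L ^+ 2 * limn (series (acv_limit_term L c^-1)).
  rewrite -[RHS]/(_ *: _) -lim_seriesZ// /tail_energy; congr (limn (series _)).
  apply/funext => k; rewrite -[RHS]/(_ * acv_limit_term L c^-1 k).
  rewrite /acv_limit_term glimit_poisson// exprVn.
  by field; rewrite f expf_neq0 ?gt_eqF.
by rewrite mulrAC divff ?mul1r// expf_neq0// gt_eqF.
Qed.

Let Ein_bracket arb c : R :=
  Ein c - 2 * Ein (c + ln arb) + Ein ((c + ln arb) ^+ 2 / c).

(** Euler's constant enters with weights 1, -2, 1, and the logarithms cancel since the third
    argument is the square of the second over the first. Only the entire parts remain, which is why
    the singularity is removable. *)
Lemma bracketE arb c : 0 < c -> c + ln arb != 0 -> bracket arb c = Ein_bracket arb c.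
Proof.
move=> c0 cl; rewrite /bracket /Ei !Ein_intE [ln arb + c]addrC.
have cl0 : 0 < `|c + ln arb| by rewrite normr_gt0.
have -> : ln `|(c + ln arb) ^+ 2 / c| = 2 * ln `|c + ln arb| - ln `|c|.
  have cc : 0 < `|c| by rewrite normr_gt0 gt_eqF.
  rewrite normrM normrX normrV ?unitfE ?(gt_eqF c0)// ln_div ?posrE ?exprn_gt0//.
  by rewrite lnXn// mulr_natl.
by rewrite /Ein_bracket; ring.
Qed.

Lemma bracket_extE arb c : 0 < c -> bracket_ext arb c = Ein_bracket arb c.
Proof.
move=> c0; rewrite /bracket_ext; case: ifPn => [cl|].
  by apply: bracketE => //; rewrite addr_eq0.
rewrite negbK => /eqP cl; rewrite -cl; apply/cvg_lim => //.
have E : \forall y \near c^', Ein_bracket arb y = bracket arb y.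
  near=> y; rewrite bracketE//.
    near: y; apply: nbhs_dnbhs; exact: lt_nbhsr.
  have : y != c by near: y; exact: nbhs_dnbhs_neq.
  by rewrite addr_eq0 -cl.
apply: cvg_trans (near_eq_cvg E) _.
apply: cvg_within_filter.
have cEin (g : R -> R) : {for c, continuous g} -> Ein (g y) @[y --> c] --> Ein (g c).
  move=> cg; apply: (@continuous_comp _ _ _ g Ein) => //.
  exact: is_derive_continuous (is_derive_Ein _).
have cD : (y + ln arb) @[y --> c] --> c + ln arb.
  by apply: cvgD; [exact: cvg_id|exact: cvg_cst].
apply: cvgD; last first.
  apply: (cEin (fun y => (y + ln arb) ^+ 2 / y)); apply: cvgM; first exact: cvg_exprn.
  by apply: cvgV; [rewrite gt_eqF|exact: cvg_id].
apply: cvgB; first exact: (cEin id).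
by apply: cvgM; [exact: cvg_cst|exact: (cEin (fun y => y + ln arb))].
Unshelve. all: by end_near. Qed.

Lemma A_acv_limit arb C : 0 < arb -> arb < 1 -> 0 < C ->
  A C arb = acv_limit (- ln arb) (4 / C).
Proof.
move=> a0 a1 C0; have L0 : 0 < - ln arb by rewrite oppr_gt0 ln_lt0// a0.
have c0 : 0 < C / 4 by rewrite divr_gt0.
have -> : 4 / C = (C / 4)^-1 by rewrite invf_div.
rewrite acv_limit_energy// tail_energyE// /A bracket_extE// /Ein_bracket opprK.
have -> : poisson_tail 1 (- ln arb) = 1 - arb.
  by rewrite poisson_tailS poisson_tail0 expr0 divr1 mulr1 opprK lnK.
by rewrite mulrAC.
Qed.

Lemma acv_limit_lt L s s' : 0 < L -> 0 < s -> s < s' -> acv_limit L s < acv_limit L s'.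
Proof.
move=> L0 s0 ss.
have c1 := is_cvg_acv_limit L0 (ltW s0).
have c2 := is_cvg_acv_limit L0 (ltW (lt_trans s0 ss)).
rewrite -subr_gt0 /acv_limit -lim_seriesB//.
set u := (_ - _).
have u_ge0 k : 0 <= u k.
  rewrite subr_ge0 /acv_limit_term ler_wpM2r ?invr_ge0// ler_wpM2l ?sqr_ge0//.
  by rewrite lerXn2r ?nnegrE ?(ltW s0) ?(ltW ss) ?(ltW (lt_trans s0 ss)).
have cu : cvgn (series u) by exact: is_cvg_seriesB.
have u0 : 0 < u 0%N.
  rewrite subr_gt0 /acv_limit_term !expr1 ltr_pM2r ?invr_gt0//.
  by rewrite ltr_pM2l// exprn_gt0// glimit_gt0.
apply: (lt_le_trans u0); have -> : u 0%N = series u 1%N by rewrite /series /= big_nat1.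
by apply: nondecreasing_cvgn_le cu _; apply: nondecreasing_series.
Qed.

Lemma acv_limit_surj L v : 0 < L -> 0 < v -> exists2 s, 0 < s & acv_limit L s = v.
Proof.
move=> L0 v0.
(* The absolute value makes the function continuous on the whole line, as continuity is known only
   for nonnegative arguments. *)
pose f s := acv_limit L `|s|.
have cf : continuous f.
  move=> s; apply: (@cvg_acv_limit R R (nbhs s) _ (fun u => `|u|)) => //.
    by apply: nearW => u; exact: normr_ge0.
  exact: norm_continuous.
have f0 : f 0 = 0.
  rewrite /f normr0 /acv_limit; apply/cvg_lim => //.
  apply: cvg_trans (@cvg_cst _ (0 : R) nat \oo _); apply: near_eq_cvg; apply: nearW => n.
  rewrite /series /= big1// => i _.
  by rewrite /acv_limit_term expr0n mulr0 mul0r.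
have g1 := glimit_gt0 1 L0.
(* At this argument the first term alone equals v. *)
pose b := v / glimit L 1 ^+ 2.
have b0 : 0 < b by rewrite divr_gt0// exprn_gt0.
have fb : v <= f b.
  rewrite /f gtr0_norm//.
  have -> : v = series (fun k => acv_limit_term L b k.+1) 1%N.
    rewrite /series /= big_nat1 /acv_limit_term (_ : 1`! = 1%N)// divr1 expr1 /b.
    by field; rewrite gt_eqF.
  apply: nondecreasing_cvgn_le; last exact: is_cvg_acv_limit (ltW b0).
  by apply: nondecreasing_series => k _ _; rewrite ltW// acv_limit_term_gt0.
have [|s] := @IVT R f 0 b v (ltW b0) (continuous_subspaceT cf).
  by rewrite f0 min_l ?max_r ?(ltW v0)// (le_trans (ltW v0)).
rewrite in_itv /= => /andP[s0 _] fs; exists s; last by rewrite -fs /f ger0_norm.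
by rewrite lt_def s0 andbT; apply: contra_eq_neq fs => ->; rewrite f0 lt_eqF.
Qed.

End limit_closed_form.

(** * Optimal sizes *)

Section nu_dagger_asymptotics.
Context {R : realType}.

Lemma cvg_onem_at_left1 : 1 - z @[z --> (1 : R)^'-] --> (0 : R).
Proof.
rewrite -(subrr (1 : R)); apply: cvgB; first exact: cvg_cst.
by apply: cvg_at_left_filter; exact: cvg_id.
Qed.

(** Squeezed between -1 and -z, by ln z <= z - 1 and - ln z <= 1 / z - 1. *)
Lemma cvg_ln_ratio : (1 - z) / ln z @[z --> (1 : R)^'-] --> (-1 : R).
Proof.
have lo : -1 @[z --> (1 : R)^'-] --> (-1 : R) by exact: cvg_cst.
have hi : - z @[z --> (1 : R)^'-] --> (-1 : R).
  by apply: cvgN; apply: cvg_at_left_filter; exact: cvg_id.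
apply: squeeze_cvgr lo hi; near=> z.
have z1 : z < 1 by near: z; exact: nbhs_left_lt.
have z0 : 0 < z by near: z; exact: nbhs_left_gt.
have l0 : ln z < 0 by rewrite ln_lt0// z0.
have up : ln z <= z - 1.
  by have := @le_ln1Dx R (z - 1); have -> : 1 + (z - 1) = z by [ring]; apply; lra.
have dn : - ln z <= z^-1 - 1.
  have := @le_ln1Dx R (z^-1 - 1); have -> : 1 + (z^-1 - 1) = z^-1 by ring.
  rewrite lnV ?posrE//; apply.
  have : 0 < z^-1 by rewrite invr_gt0.
  lra.
have dn' : - ln z * z <= 1 - z.
  by have := ler_wpM2r (ltW z0) dn; rewrite mulrBl mulVf ?gt_eqF// mul1r.
apply/andP; split.
  by rewrite ler_ndivlMr// mulN1r; lra.
by rewrite ler_ndivrMr//; lra.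
Unshelve. all: by end_near. Qed.

Variables (arb b : R).
Hypotheses (arb_gt0 : 0 < arb) (arb_lt1 : arb < 1) (b_ge0 : 0 <= b).

Lemma ARB_nu_dagger (z : R) : 0 < z < 1 -> ARB z (nu_dagger arb b z) = arb * z `^ b.
Proof.
move=> /andP[z0 z1]; have lz : ln z != 0 by rewrite lt_eqF// ln_lt0// z0.
rewrite /ARB /nu_dagger powRD; last by rewrite (gt_eqF z0) /= implybT.
by congr (_ * _); rewrite /powR gt_eqF// divfK// lnK.
Qed.

Lemma cvg_nu_dagger : (1 - z) * nu_dagger arb b z @[z --> (1 : R)^'-] --> - ln arb.
Proof.
have -> : (fun z : R => (1 - z) * nu_dagger arb b z) =
   (fun z => (1 - z) / ln z * ln arb + (1 - z) * b).
  by apply/funext => z; rewrite /nu_dagger; ring.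
have -> : - ln arb = -1 * ln arb + 0 * b by ring.
apply: cvgD.
  by apply: cvgM; [exact: cvg_ln_ratio|exact: cvg_cst].
by apply: cvgM; [exact: cvg_onem_at_left1|exact: cvg_cst].
Qed.

Lemma near_nu_dagger : \forall z \near (1 : R)^'-,
  [/\ 0 < nu_dagger arb b z, 0 < 1 - z, 1 - z <= 4^-1 &
      (nu_dagger arb b z + 1) * (1 - z) <= - ln arb + 1].
Proof.
have c : (1 - z) * nu_dagger arb b z + (1 - z) @[z --> (1 : R)^'-] --> - ln arb + 0.
  by apply: cvgD; [exact: cvg_nu_dagger|exact: cvg_onem_at_left1].
near=> z.
have z1 : z < 1 by near: z; exact: nbhs_left_lt.
have z0 : 0 < z by near: z; exact: nbhs_left_gt.
split.
- have la : ln arb < 0 by rewrite ln_lt0// arb_gt0.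
  have lz : ln z < 0 by rewrite ln_lt0// z0.
  by rewrite /nu_dagger ltr_pwDl// nmulr_rgt0// invr_lt0.
- by rewrite subr_gt0.
- by near: z; apply: cvgr_le cvg_onem_at_left1 _ _.
- rewrite mulrDl mul1r mulrC; near: z; apply: (cvgr_le _ c).
  by rewrite addr0 ltrDl.
Unshelve. all: by end_near. Qed.

End nu_dagger_asymptotics.

Section optimal_sizes.
Context {R : realType}.

Lemma acv_term_le2 (n1 n2 m1 m2 z nu : R) k : 1 < m1 -> 1 < m2 -> m1 <= n1 -> m2 <= n2 ->
  acv_term n1 n2 z nu k <= acv_term m1 m2 z nu k.
Proof.
move=> h1 h2 mn1 mn2; apply: ler_sum => l _.
have g1 := lt_le_trans h1 mn1; have g2 := lt_le_trans h2 mn2.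
rewrite ler_wpM2l ?sqr_ge0// lef_pV2 ?posrE ?acv_denom_gt0//.
have poch_le (m n : R) j : 1 < m -> m <= n ->
    0 <= poch (Defs.shape m) j <= poch (Defs.shape n) j.
  move=> m1' mn; rewrite (ltW (poch_gt0 _ (shape_gt0 m1')))/=.
  apply: ler_prod => i _; rewrite addr_ge0 ?(ltW (shape_gt0 m1'))//=.
  by rewrite lerD2r /Defs.shape; lra.
have /andP[p1 q1] := poch_le _ _ l h1 mn1.
have /andP[p2 q2] := poch_le _ _ (k - l)%N h2 mn2.
by rewrite !ler_wpM2r// ler_pM.
Qed.

Lemma ACV2_le2 (n1 n2 m1 m2 z nu : R) : 1 < m1 -> 1 < m2 -> m1 <= n1 -> m2 <= n2 ->
  (ACV2 n1 n2 z nu <= ACV2 m1 m2 z nu)%E.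
Proof.
move=> h1 h2 mn1 mn2; apply: lee_nneseries => [k _ _|k _].
  by rewrite lee_fin (acv_term_ge0 _ _ _ (lt_le_trans h1 mn1) (lt_le_trans h2 mn2)).
by rewrite lee_fin; exact: acv_term_le2.
Qed.

Lemma optimal_sizes_atP (z nu acv n1 n2 : R) : 0 < acv ->
  optimal_sizes_at (fun m1 m2 => ACV m1 m2 z nu) acv n1 n2 <->
  [/\ 1 < n1, 1 < n2, ACV2 n1 n2 z nu = (acv ^+ 2)%:E &
    forall m1 m2, 1 < m1 -> 1 < m2 -> m1 + m2 = n1 + n2 ->
      ((acv ^+ 2)%:E <= ACV2 m1 m2 z nu)%E].
Proof.
move=> a0; have sqE : sqrte (acv ^+ 2)%:E = acv%:E by rewrite /= sqrtr_sqr gtr0_norm.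
split=> [[N [N0 [h1 h2 nN opt] e]]|[h1 h2 e opt]].
  have e2 : ACV2 n1 n2 z nu = (acv ^+ 2)%:E.
    rewrite -[LHS]sqr_sqrte ?ACV2_ge0//.
    by move: e; rewrite /ACV => ->; rewrite -EFin_expe.
  split=> // m1 m2 g1 g2 mn; rewrite -e2 -lee_sqrt ?ACV2_ge0//.
  by apply: opt => //; rewrite mn.
exists (n1 + n2); split; [lra| |by rewrite /ACV e].
split=> // m1 m2 g1 g2 mn; rewrite /ACV lee_sqrt ?ACV2_ge0// e.
exact: opt.
Qed.

(* [b + b^-1 - 2 = (b - 1) ^+ 2 / b], so two scaled sizes whose sum and sum of
   inverses both barely exceed 2 are both close to 1. *)
Lemma scaled_size_bound (b1 b2 e : R) : 0 < b1 -> 0 < b2 -> 0 < e -> e <= 1 ->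
  b1 + b2 < 2 * (1 + e) -> b1^-1 + b2^-1 < 2 * (1 + e) -> (b1 - 1) ^+ 2 < 16 * e.
Proof.
move=> b10 b20 e0 e1 h1 h2.
have E (y : R) : 0 < y -> y + y^-1 - 2 = (y - 1) ^+ 2 / y.
  by move=> y0; field; rewrite gt_eqF.
have q1 : (b1 - 1) ^+ 2 / b1 < 4 * e.
  have : 0 <= (b2 - 1) ^+ 2 / b2 by rewrite divr_ge0 ?sqr_ge0 ?ltW.
  rewrite -!E//; lra.
rewrite ltr_pdivrMr// in q1; apply: (lt_le_trans q1).
(* As b2 > 0 and e <= 1, b1 < 2 (1 + e) <= 4. *)
nra.
Qed.

End optimal_sizes.

Unset Implicit Arguments.

Theorem theorem17 (R : realType) (acv0 arb0 b : R)
    (acv0_gt0 : 0 < acv0) (arb0_gt0 : 0 < arb0) (arb0_lt1 : arb0 < 1)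
    (b_ge0 : 0 <= b) :
  let opt (zeta n1 n2 : R) :=
    optimal_sizes_at
      (fun m1 m2 => ACV m1 m2 zeta (nu_dagger arb0 b zeta)) acv0 n1 n2 in
  [/\ (forall zeta : R, 0 < zeta < 1 ->
         ARB zeta (nu_dagger arb0 b zeta) = arb0 * zeta `^ b),
      (\forall zeta \near 1^'-, exists n1 n2 : R, opt zeta n1 n2) &
      exists C : R,
        [/\ 0 < C,
            A C arb0 - acv0 ^+ 2 = 0,
            (forall C' : R, 0 < C' -> A C' arb0 - acv0 ^+ 2 = 0 -> C' = C) &
            forall n1 n2 : R -> R,
              (\forall zeta \near 1^'-, opt zeta (n1 zeta) (n2 zeta)) ->
              [/\ n2 zeta / n1 zeta @[zeta --> 1^'-] --> (1 : R),
                  n1 ~_(1^'-) (fun zeta => C * (1 - zeta) ^- 2) &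
                  n2 ~_(1^'-) (fun zeta => C * (1 - zeta) ^- 2)]]].
Proof.
move=> opt.
pose v := acv0 ^+ 2; have v0 : 0 < v by exact: exprn_gt0.
pose L := - ln arb0.
have L0 : 0 < L by rewrite oppr_gt0 ln_lt0// arb0_gt0.
have [s s0 sv] := acv_limit_surj L0 v0.
have x0 := @cvg_onem_at_left1 R.
have xnu := @cvg_nu_dagger R arb0 b.
have bounds := near_nu_dagger arb0_gt0 arb0_lt1 b_ge0.
have F : ProperFilter (1 : R)^'- by exact: at_left_proper_filter.
have zE (z : R) : 1 - (1 - z) = z by rewrite subKr.
(* Any upper bound [s1 > s] on [(2 / n1 + 2 / n2) / x ^+ 2] is forced by [ACV2 <= v]. *)
have lower (s1 : R) : s < s1 -> \forall z \near (1 : R)^'-, forall n1 n2 : R,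
    1 < n1 -> 1 < n2 -> (ACV2 n1 n2 z (nu_dagger arb0 b z) <= v%:E)%E ->
    2 / n1 + 2 / n2 < s1 * (1 - z) ^+ 2.
  move=> ss; have s10 : 0 < s1 by exact: lt_trans ss.
  have vs1 : v < acv_limit L s1 by rewrite -sv; exact: acv_limit_lt.
  have := ACV2_lower F x0 xnu bounds L0 s10 (ltW v0) vs1.
  apply: filterS => z H n1 n2 h1 h2; rewrite ltNge; apply: contraTN => /(H _ _ h1 h2).
  by rewrite zE ltNge.
(* Balanced sizes c x^-2 with c above the predicted constant 4 / s eventually bring ACV^2 strictly
   below v. *)
have upper (c : R) : 0 < c -> 4 / c < s -> \forall z \near (1 : R)^'-,
    1 < c * (1 - z) ^- 2 /\
    (ACV2 (c * (1 - z) ^- 2) (c * (1 - z) ^- 2) z (nu_dagger arb0 b z) < v%:E)%E.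
  move=> c0 cs; have [fin lim] := cvg_ACV2_diagonal F x0 xnu bounds L0 c0.
  have limv : acv_limit L (4 / c) < v by rewrite -sv acv_limit_lt// divr_gt0.
  have [U maj] := near_acv_majorant F x0 bounds c0.
  near=> z.
  have c1 : 1 < c * (1 - z) ^- 2.
    suff : forall n1 n2 : R, c * (1 - z) ^- 2 <= n1 -> c * (1 - z) ^- 2 <= n2 ->
      [/\ 1 < n1, 1 < n2 & forall k, acv_term n1 n2 (1 - (1 - z)) (nu_dagger arb0 b z) k.+1
        <= acv_majorant (- ln arb0 + 1) U k].
      by move=> /(_ _ _ (lexx _) (lexx _))[].
    by near: z.
  split=> //.
  have : ACV2 (c * (1 - z) ^- 2) (c * (1 - z) ^- 2) (1 - (1 - z)) (nu_dagger arb0 b z) =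
      (acv_sum (c * (1 - z) ^- 2) (c * (1 - z) ^- 2) (1 - (1 - z)) (nu_dagger arb0 b z))%:E.
    by near: z.
  rewrite zE => ->; rewrite lte_fin.
  have : acv_sum (c * (1 - z) ^- 2) (c * (1 - z) ^- 2) (1 - (1 - z)) (nu_dagger arb0 b z) < v.
    by near: z; exact: (cvgr_lt _ lim).
  by rewrite zE.
split.
- exact: ARB_nu_dagger.
(* Any value above s would serve: each of 2 / n1 and 2 / n2 is then below (s + 1) x^2, which forces
   both sizes above the threshold [a]. Likewise 8 / s is merely a constant above 4 / s. *)
- have s1 : s < s + 1 by rewrite ltrDl.
  have s10 : 0 < s + 1 by rewrite addr_gt0.
  have d0 : 0 < 2 / (s + 1) by rewrite divr_gt0.
  have [U maj] := near_acv_majorant F x0 bounds d0.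
  have c20 : 0 < 8 / s by rewrite divr_gt0.
  have c2s : 4 / (8 / s) < s by rewrite invf_div mulrCA -[ltRHS]mulr1 ltr_pM2l//; lra.
  near=> z.
  have [nu0 xt0 _ _] : [/\ 0 < nu_dagger arb0 b z, 0 < 1 - z, 1 - z <= 4^-1 &
      (nu_dagger arb0 b z + 1) * (1 - z) <= - ln arb0 + 1] by near: z.
  have X2 : 0 < (1 - z) ^+ 2 by exact: exprn_gt0.
  have majz : forall n1 n2 : R, 2 / (s + 1) * (1 - z) ^- 2 <= n1 ->
      2 / (s + 1) * (1 - z) ^- 2 <= n2 ->
    [/\ 1 < n1, 1 < n2 & forall k, acv_term n1 n2 (1 - (1 - z)) (nu_dagger arb0 b z) k.+1
        <= acv_majorant (- ln arb0 + 1) U k] by near: z.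
  have low : forall n1 n2 : R,
    1 < n1 -> 1 < n2 -> (ACV2 n1 n2 z (nu_dagger arb0 b z) <= v%:E)%E ->
    2 / n1 + 2 / n2 < (s + 1) * (1 - z) ^+ 2 by near: z; exact: lower.
  have [m1 mv] : 1 < 8 / s * (1 - z) ^- 2 /\
    (ACV2 (8 / s * (1 - z) ^- 2) (8 / s * (1 - z) ^- 2) z (nu_dagger arb0 b z) < v%:E)%E.
    by near: z; exact: upper.
  rewrite zE in majz; pose a := 2 / (s + 1) * (1 - z) ^- 2.
  have [a1 _ _] := majz _ _ (lexx _) (lexx _).
  have maj_le n1 n2 : a <= n1 -> a <= n2 -> forall k,
      acv_term n1 n2 z (nu_dagger arb0 b z) k.+1 <= acv_majorant (- ln arb0 + 1) U k.
    by move=> g1 g2; have [] := majz _ _ g1 g2.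
  have gt_a n : 1 < n -> 2 / n < (s + 1) * (1 - z) ^+ 2 -> a < n.
    move=> n1; have np : 0 < n by exact: lt_trans n1.
    rewrite ltr_pdivrMr// => h; rewrite /a ltr_pdivrMr// ltr_pdivrMr//.
    by apply: lt_le_trans h _; rewrite le_eqVlt; apply/orP; left; apply/eqP; ring.
  have [|n1 [n2 [h1 h2 e hopt]]] := @ACV2_minimizer R z (nu_dagger arb0 b z) a _ a1
    (@is_cvg_acv_majorant R (- ln arb0 + 1) U) maj_le v (8 / s * (1 - z) ^- 2) _ m1 (ltW mv).
    move=> n1 n2 h1 h2 /(low _ _ h1 h2) h.
    have p1 : 0 < 2 / n1 by rewrite divr_gt0// (lt_trans ltr01).
    have p2 : 0 < 2 / n2 by rewrite divr_gt0// (lt_trans ltr01).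
    by split; apply: gt_a => //; lra.
  by exists n1, n2; apply/optimal_sizes_atP.
exists (4 / s); have C0 : 0 < 4 / s by rewrite divr_gt0.
have sC : 4 / (4 / s) = s by field; rewrite gt_eqF.
split=> //.
- by rewrite A_acv_limit// sC sv subrr.
- move=> C' C'0; rewrite A_acv_limit// => /eqP; rewrite subr_eq0 => /eqP e.
  have s'0 : 0 < 4 / C' by rewrite divr_gt0.
  suff <- : 4 / C' = s by field; rewrite gt_eqF.
  have [ss|ss|//] := ltgtP (4 / C') s.
    by have := acv_limit_lt L0 s'0 ss; rewrite e sv ltxx.
  by have := acv_limit_lt L0 s0 ss; rewrite e sv ltxx.
move=> n1 n2 nopt.
pose C := 4 / s; rewrite -/C in C0 sC *.
pose b1 z := n1 z * (1 - z) ^+ 2 / C; pose b2 z := n2 z * (1 - z) ^+ 2 / C.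
have close (e : R) : 0 < e -> e <= 1 -> \forall z \near (1 : R)^'-,
    (b1 z - 1) ^+ 2 < 16 * e /\ (b2 z - 1) ^+ 2 < 16 * e.
  move=> e0 e1.
  have s1 : s < s * (1 + e) by rewrite ltr_pMr// ltrDl.
  have c0 : 0 < C * (1 + e) by rewrite mulr_gt0//; lra.
  have cs : 4 / (C * (1 + e)) < s.
    have e10 : 0 < 1 + e by lra.
    have -> : 4 / (C * (1 + e)) = s / (1 + e) by rewrite -sC; field; rewrite !gt_eqF.
    by rewrite ltr_pdivrMr.
  near=> z.
  have [_ xt0 _ _] : [/\ 0 < nu_dagger arb0 b z, 0 < 1 - z, 1 - z <= 4^-1 &
      (nu_dagger arb0 b z + 1) * (1 - z) <= - ln arb0 + 1] by near: z.
  have X2 : 0 < (1 - z) ^+ 2 by exact: exprn_gt0.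
  have low : forall n1 n2 : R,
    1 < n1 -> 1 < n2 -> (ACV2 n1 n2 z (nu_dagger arb0 b z) <= v%:E)%E ->
    2 / n1 + 2 / n2 < s * (1 + e) * (1 - z) ^+ 2 by near: z; exact: lower.
  have [m1 mv] : 1 < C * (1 + e) * (1 - z) ^- 2 /\
    (ACV2 (C * (1 + e) * (1 - z) ^- 2) (C * (1 + e) * (1 - z) ^- 2) z
      (nu_dagger arb0 b z) < v%:E)%E.
    by near: z; exact: upper.
  have oz : opt z (n1 z) (n2 z) by near: z.
  have [h1 h2 ev hopt] := (optimal_sizes_atP _ _ _ _ acv0_gt0).1 oz.
  have p1 : 0 < n1 z by lra.
  have p2 : 0 < n2 z by lra.
  have b10 : 0 < b1 z by rewrite divr_gt0// mulr_gt0.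
  have b20 : 0 < b2 z by rewrite divr_gt0// mulr_gt0.
  (* This half uses only that the value v is attained. *)
  have sum_inv : (b1 z)^-1 + (b2 z)^-1 < 2 * (1 + e).
    have := low _ _ h1 h2; rewrite ev lexx => /(_ isT).
    rewrite -(ltr_pM2r (divr_gt0 C0 X2)).
    have -> : (2 / n1 z + 2 / n2 z) * (C / (1 - z) ^+ 2) = 2 * ((b1 z)^-1 + (b2 z)^-1).
      by rewrite /b1 /b2; field; rewrite !gt_eqF.
    have -> : s * (1 + e) * (1 - z) ^+ 2 * (C / (1 - z) ^+ 2) = 4 * (1 + e).
      by rewrite /C; field; rewrite !gt_eqF.
    lra.
  (* This half uses optimality: a larger total, split evenly, would give two sizes of at least C (1
     + e) x^-2, and by monotonicity in the sizes a value below v. *)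
  have sum_lt : b1 z + b2 z < 2 * (1 + e).
    rewrite ltNge; apply/negP => big.
    pose m := (n1 z + n2 z) / 2.
    have cm : C * (1 + e) * (1 - z) ^- 2 <= m.
      rewrite ler_pdivrMr//.
      have : C * (2 * (1 + e)) <= C * (b1 z + b2 z) by rewrite ler_pM2l.
      have -> : C * (b1 z + b2 z) = 2 * (m * (1 - z) ^+ 2).
        by rewrite /b1 /b2 /m; field; rewrite gt_eqF.
      lra.
    have m1' : 1 < m by exact: lt_le_trans cm.
    have := hopt m m m1' m1'; rewrite /m -splitr => /(_ erefl).
    apply/negP; rewrite -ltNge; apply: le_lt_trans mv.
    exact: ACV2_le2.
  split; first exact: scaled_size_bound sum_inv.
  by apply: (@scaled_size_bound R (b2 z) (b1 z)) => //; rewrite addrC.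
have near_dist (e : R) : 0 < e -> \forall z \near (1 : R)^'-,
    `|b1 z - 1| <= e /\ `|b2 z - 1| <= e.
  (* Makes the bound 16 e' on the squares at most e^2 while keeping e' <= 1. *)
  move=> e0; pose e' := Num.min 1 (e ^+ 2 / 16).
  have e'0 : 0 < e' by rewrite lt_min ltr01 divr_gt0// exprn_gt0.
  have e'1 : e' <= 1 by rewrite ge_min lexx.
  have e'e : 16 * e' <= e ^+ 2.
    have : e' <= e ^+ 2 / 16 by rewrite ge_min lexx orbT.
    by rewrite ler_pdivlMr// mulrC.
  have sq (y : R) : y ^+ 2 < 16 * e' -> `|y| <= e.
    move=> ye; rewrite -(@ler_pXn2r _ 2)// ?nnegrE ?(ltW e0)//.
    by rewrite real_normK ?num_real// (le_trans (ltW ye)).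
  by apply: filterS (close _ e'0 e'1) => z [/sq ? /sq ?].
have cb1 : b1 z @[z --> (1 : R)^'-] --> (1 : R).
  apply/cvgrPdist_le => e e0; apply: filterS (near_dist _ e0) => z [].
  by rewrite distrC.
have cb2 : b2 z @[z --> (1 : R)^'-] --> (1 : R).
  apply/cvgrPdist_le => e e0; apply: filterS (near_dist _ e0) => z [_].
  by rewrite distrC.
have xpos : \forall z \near (1 : R)^'-, 0 < 1 - z.
  by near=> z; rewrite subr_gt0; near: z; exact: nbhs_left_lt.
have equiv (n : R -> R) : (forall e : R, 0 < e ->
      \forall z \near (1 : R)^'-, `|n z * (1 - z) ^+ 2 / C - 1| <= e) ->
    n ~_((1 : R)^'-) (fun z => C * (1 - z) ^- 2).
  move=> nd; apply/eqaddoP => e e0; apply: filterS2 xpos (nd _ e0) => z xz nz.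
  have g0 : 0 < C * (1 - z) ^- 2 by rewrite divr_gt0// exprn_gt0.
  have -> : (n - (fun z => C * (1 - z) ^- 2)) z =
      (n z * (1 - z) ^+ 2 / C - 1) * (C * (1 - z) ^- 2).
    rewrite -[LHS]/(n z - C * (1 - z) ^- 2); field.
    by rewrite !gt_eqF.
  by rewrite normrM ler_pM2r// normr_gt0 gt_eqF.
split.
- have : b2 z / b1 z @[z --> (1 : R)^'-] --> (1 : R) / 1.
    by apply: cvgM => //; apply: cvgV => //; exact: oner_neq0.
  rewrite divr1; apply: cvg_trans; apply: near_eq_cvg.
  near=> z; have xz : 0 < 1 - z by near: z.
  (* If n1 vanishes, both quotients are 0 by the convention on division. *)
  have [n10|n1n0] := eqVneq (n1 z) 0.
    by rewrite /b1 n10 !mul0r invr0 !mulr0.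
  by rewrite /b1 /b2; field; rewrite n1n0 !gt_eqF.
- by apply: equiv => e /near_dist; apply: filterS => z [].
- by apply: equiv => e /near_dist; apply: filterS => z [].
Unshelve. all: by end_near. Qed.
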